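(* Let $\xi$ be a real random variable with mean zero, variance one, and bounded $(2+\varepsilon)$-moment (for some fixed $\varepsilon>0$), and let $\xi_0,\xi_1,\dots$ be i.i.d. copies of $\xi$. Consider either (E) the (normalized) Elliptic polynomial $F(x)=\sum_{j=0}^n\xi_j\sqrt{\binom nj}(x/\sqrt n)^j$ with $I=[-C_E\sqrt n,\,C_E\sqrt n]$, where $C_E>0$ is fixed, or (W) the Weyl polynomial $F(x)=\sum_{j=0}^n\xi_j\frac{x^j}{\sqrt{j!}}$ with $I=[\frac1{C_W}\sqrt n,\,C_W\sqrt n]$ or $I=[-C_W\sqrt n,\,-\frac1{C_W}\sqrt n]$, where $C_W>1$ is fixed. Let $N_I$ be the number of roots of $F$ in $I$. Assume that $A=A(n)$ satisfies $\log^4 n\ll A\ll\sqrt n$. Then there exists a constant $c>0$ such that, in both models, $$\mathbb{P}(N_I\ge A\sqrt n)\le 2^{-cA}+\exp\big(-\Theta(\sqrt n/\log^2 n)\big).$$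
   Context: $n$ is an asymptotic parameter going to infinity. $X\ll Y$ means $|X|\le CY$ for some fixed constant $C$ (which may depend on other fixed quantities). $\Theta(Y)$ denotes a quantity bounded above and below by fixed positive multiples of $Y$; so the second term means $\exp(-c'\sqrt n/\log^2 n)$ for some fixed constant $c'>0$. *)

(* Defs.v *)
From HB Require Import structures.
From mathcomp Require Import all_boot all_order all_algebra finmap.
From mathcomp Require Import all_classical all_reals all_analysis.

Set Implicit Arguments.
Unset Strict Implicit.
Unset Printing Implicit Defensive.

Import Order.TTheory GRing.Theory Num.Theory.
Import numFieldNormedType.Exports.

Local Open Scope classical_set_scope.
Local Open Scope ring_scope.

(* Product rule over every finite subfamily. *)
Definition mutually_independent (R : realType) (d : measure_display)
    (T : measurableType d) (P : probability T R) (X : nat -> {RV P >-> R}) :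
    Prop :=
  forall (J : {fset nat}) (B : nat -> set R),
    (forall j, j \in J -> measurable (B j)) ->
    P (\bigcap_(j in [set` J]) (X j @^-1` B j)) =
    (\prod_(j <- J) P (X j @^-1` B j))%E.

(* Laws are compared on Borel sets only: the values of a measure outside its
   sigma-algebra are unspecified. *)
Definition iid_copies (R : realType) (d : measure_display)
    (T : measurableType d) (P : probability T R)
    (X : {RV P >-> R}) (Xs : nat -> {RV P >-> R}) : Prop :=
  (forall (j : nat) (B : set R), measurable B ->
     distribution P (Xs j) B = distribution P X B) /\
  mutually_independent Xs.

(* X << Y in the sense of Vinogradov, as n tends to infinity. *)
Definition vinogradov (R : realType) (X Y : nat -> R) : Prop :=
  exists C : R, 0 < C /\ \forall n \near \oo, `|X n| <= C * Y n.

Definition elliptic_poly (R : realType) (n : nat) (a : nat -> R) : {poly R} :=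
  \poly_(j < n.+1)
    (a j * Num.sqrt ('C(n, j)%:R) / (Num.sqrt n%:R) ^+ j).

Definition weyl_poly (R : realType) (n : nat) (a : nat -> R) : {poly R} :=
  \poly_(j < n.+1) (a j / Num.sqrt (j`!%:R)).

(* Number of roots of p in I, counted with multiplicity.  The zero polynomial
   needs a separate case because [mup x 0 = 0]. *)
Definition nroots (R : realType) (I : set R) (p : {poly R}) : \bar R :=
  if p == 0 then +oo%E else (\esum_(x in I) (mup x p)%:R%:E)%E.

Definition many_roots (R : realType) (d : measure_display)
    (T : measurableType d) (P : probability T R) (xi : nat -> {RV P >-> R})
    (F : (nat -> R) -> {poly R}) (I : set R) (m : R) : set T :=
  [set w | (m%:E <= nroots I (F (fun j => xi j w)))%E].

(* Main.v *)
Require Import Defs.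
From HB Require Import structures.
From mathcomp Require Import all_boot all_order all_algebra finmap.
From mathcomp Require Import all_classical all_reals all_analysis.
From mathcomp Require Import measurable_realfun ring lra zify.

(* If a polynomial has N roots within distance lam of 0, dividing out each of them
   lowers the majorant norm sum_i |p_i| tau^i by a factor tau - lam, so with
   tau = 9 lam the polynomial is at most 4^-N times its norm on [-lam, lam].
   Near a point x0 we write x = x0 (1 + t) and apply this to
   (1 - t)^J F(x0 (1 + t)), where J is the index of the largest term of F at x0:
   the factor (1 - t)^J cancels the exponential growth in t, and log-concavity
   of the weights keeps the norm below e^(O(n lam^2)) times the largest term.

   Suppose two coefficient vectors are almost equal outside a window of k
   consecutive indices around J, and that both polynomials have many roots near x0.
   Then the difference, essentially a k-term polynomial, is tiny
   near x0, and Newton interpolation forces the coefficients in the window to be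
   close as well.  Hence, given the coefficients outside the window,
   each coefficient in the window is confined to a short interval, and
   independence and non-degeneracy bound the probability by q^k with q < 1.

   With lam = ln^2 n / sqrt n, about sqrt n / ln n points x0 in geometric
   progression suffice to cover |x| <= K sqrt n, so A sqrt n roots put at least
   A ln n / 5 of them near one x0.  This beats all losses for k = A / 100, and a
   union bound over the points x0 and over the event max |xi_j| > e^A concludes. *)

Set Implicit Arguments.
Unset Strict Implicit.
Unset Printing Implicit Defensive.

Import Order.TTheory GRing.Theory Num.Theory.
Import numFieldNormedType.Exports.

Local Open Scope classical_set_scope.
Local Open Scope ring_scope.

(** * Majorant norm of a polynomial *)

Section PolyNorm.
Variable R : realFieldType.
Implicit Types (p q : {poly R}) (Y c t : R).

Definition pnorm Y p : R := \sum_(i < size p) `|p`_i| * Y ^+ i.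

Lemma pnorm_wide n Y p : (size p <= n)%N ->
  pnorm Y p = \sum_(i < n) `|p`_i| * Y ^+ i.
Proof.
move=> sp; rewrite /pnorm (big_ord_widen n (fun i => `|p`_i| * Y ^+ i)) //.
rewrite big_mkcond /=; apply: eq_bigr => i _; case: ltnP => // h.
by rewrite nth_default // normr0 mul0r.
Qed.

Lemma pnorm_ge0 Y p : 0 <= Y -> 0 <= pnorm Y p.
Proof. by move=> Y0; apply: sumr_ge0 => i _; rewrite mulr_ge0 ?exprn_ge0. Qed.

Lemma pnorm0 Y : pnorm Y 0 = 0.
Proof. by rewrite /pnorm size_poly0 big_ord0. Qed.

Lemma pnormD Y p q : 0 <= Y -> pnorm Y (p + q) <= pnorm Y p + pnorm Y q.
Proof.
move=> Y0; set n := maxn (size p) (size q).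
rewrite (@pnorm_wide n _ (p + q)) ?(leq_trans (size_polyD _ _)) //.
rewrite (@pnorm_wide n _ p) ?leq_maxl // (@pnorm_wide n _ q) ?leq_maxr //.
rewrite -big_split /=; apply: ler_sum => i _.
by rewrite coefD -mulrDl ler_wpM2r ?exprn_ge0 // ler_normD.
Qed.

Lemma pnormZ Y c p : pnorm Y (c *: p) = `|c| * pnorm Y p.
Proof.
rewrite (@pnorm_wide (size p)) ?size_scale_leq // /pnorm mulr_sumr.
by apply: eq_bigr => i _; rewrite coefZ normrM mulrA.
Qed.

Lemma pnorm_sum (I : Type) (r : seq I) (P : pred I) (F : I -> {poly R}) Y :
  0 <= Y -> pnorm Y (\sum_(i <- r | P i) F i) <= \sum_(i <- r | P i) pnorm Y (F i).
Proof.
move=> Y0; elim/big_ind2: _ => [|p x q y hp hq|//]; first by rewrite pnorm0.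
by rewrite (le_trans (pnormD _ _ Y0)) // lerD.
Qed.

Lemma pnorm_MXaddC Y p c : pnorm Y (p * 'X + c%:P) = pnorm Y p * Y + `|c|.
Proof.
rewrite (@pnorm_wide (size p).+1); last first.
  by rewrite size_MXaddC; case: ifP.
rewrite big_ord_recl /= coefD coefMX coefC /= add0r expr0 mulr1 addrC.
congr (_ + _); rewrite /pnorm mulr_suml; apply: eq_bigr => i _.
by rewrite /bump /= add1n coefD coefMX coefC /= addr0 exprSr mulrA.
Qed.

Lemma pnormMX Y p : pnorm Y (p * 'X) = pnorm Y p * Y.
Proof. by have := pnorm_MXaddC Y p 0; rewrite normr0 !addr0. Qed.

Lemma pnormC Y c : pnorm Y c%:P = `|c|.
Proof. by have := pnorm_MXaddC Y 0 c; rewrite pnorm0 !mul0r !add0r. Qed.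

Lemma pnormXn Y n : pnorm Y 'X^n = Y ^+ n.
Proof.
elim: n => [|n IH]; first by rewrite !expr0 -polyC1 pnormC normr1.
by rewrite !exprSr pnormMX IH.
Qed.

Lemma pnormM Y p q : 0 <= Y -> pnorm Y (p * q) <= pnorm Y p * pnorm Y q.
Proof.
move=> Y0; elim/poly_ind: p => [|p c IH]; first by rewrite mul0r pnorm0 mul0r.
rewrite pnorm_MXaddC mulrDl mul_polyC -mulrA -['X * q]mulrC mulrA.
rewrite (le_trans (pnormD _ _ Y0)) // pnormMX pnormZ mulrDl lerD2r.
by rewrite mulrAC ler_wpM2r.
Qed.

Lemma pnormX Y p n : 0 <= Y -> pnorm Y (p ^+ n) <= pnorm Y p ^+ n.
Proof.
move=> Y0; elim: n => [|n IH]; first by rewrite !expr0 -polyC1 pnormC normr1.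
by rewrite !exprS (le_trans (pnormM _ _ Y0)) // ler_wpM2l ?pnorm_ge0.
Qed.

Lemma horner_le_pnorm Y p t : `|t| <= Y -> `|p.[t]| <= pnorm Y p.
Proof.
move=> tY; rewrite horner_coef (le_trans (ler_norm_sum _ _ _)) //.
apply: ler_sum => i _; rewrite normrM normrX ler_wpM2l //.
by rewrite lerXn2r ?nnegrE // (le_trans _ tY).
Qed.

Lemma coef_le_pnorm1 p i : `|p`_i| <= pnorm 1 p.
Proof.
have [ip|pi] := ltnP i (size p); last first.
  by rewrite nth_default // normr0 pnorm_ge0.
rewrite /pnorm (bigD1 (Ordinal ip)) //= expr1n mulr1 lerDl.
by apply: sumr_ge0 => j _; rewrite expr1n mulr1.
Qed.

(** Multiplication by ['X] scales the norm by exactly [Y], and [q * 'X] differs from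
    [('X - c%:P) * q] only by [c *: q]. *)
Lemma pnorm_quo_XsubC Y q c : 0 <= Y ->
  (Y - `|c|) * pnorm Y q <= pnorm Y (('X - c%:P) * q).
Proof.
move=> Y0; rewrite mulrBl lerBlDr mulrC -pnormMX.
have -> : q * 'X = ('X - c%:P) * q + c *: q.
  by rewrite -mul_polyC; ring.
by rewrite (le_trans (pnormD _ _ Y0)) // pnormZ.
Qed.

(* Dividing by [X - r] costs a factor [tau - |r|] in [pnorm tau], while each
   factor [t - r] of [p.[t]] is at most [2 lam]. *)
Lemma horner_le_roots (lam tau : R) p (rs : seq R) t :
  0 <= lam -> lam < tau -> all (fun r => `|r| <= lam) rs -> `|t| <= lam ->
  \prod_(r <- rs) ('X - r%:P) %| p ->
  `|p.[t]| <= (2 * lam / (tau - lam)) ^+ size rs * pnorm tau p.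
Proof.
move=> lam0 lamtau rsP tlam /dvdpP[q ->] {p}.
have tau0 : 0 <= tau by rewrite (le_trans lam0) // ltW.
elim: rs rsP q => [|r rs IH] /=.
  move=> _ q; rewrite big_nil mulr1 expr0 mul1r horner_le_pnorm //.
  by rewrite (le_trans tlam) // ltW.
case/andP=> rlam rsP q; rewrite big_cons.
have -> : q * (('X - r%:P) * \prod_(j <- rs) ('X - j%:P)) =
  ('X - r%:P) * (q * \prod_(j <- rs) ('X - j%:P)) by ring.
set s := q * _.
rewrite hornerM hornerXsubC normrM exprS.
have d0 : 0 < tau - lam by rewrite subr_gt0.
have h1 : `|t - r| <= 2 * lam by rewrite (le_trans (ler_normB _ _)) //; lra.
have h2 := IH rsP q; rewrite -/s in h2.
have h3 := pnorm_quo_XsubC s r tau0.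
have h4 : pnorm tau s <= pnorm tau (('X - r%:P) * s) / (tau - lam).
  rewrite ler_pdivlMr // mulrC (le_trans _ h3) // ler_wpM2r ?pnorm_ge0 //.
  by rewrite lerD2l lerN2.
apply: (le_trans (ler_pM _ _ h1 h2)) => //.
have e0 : 0 <= (2 * lam / (tau - lam)) ^+ size rs.
  by rewrite exprn_ge0 // divr_ge0 ?(ltW d0) //; lra.
have e1 : 0 <= 2 * lam by lra.
apply: (le_trans (ler_wpM2l e1 (ler_wpM2l e0 h4))).
by rewrite le_eqVlt; apply/orP; left; apply/eqP; ring.
Qed.

(* Newton interpolation: splitting off the node [s] replaces [B] by [2 B / h]. *)
Lemma pnorm1_interpolation (h B : R) (ss : seq R) q :
  0 < h -> h <= 1 -> 0 <= B -> (size q <= size ss)%N ->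
  pairwise (fun s s' => h <= `|s - s'|) ss -> all (fun s => `|s| <= 2) ss ->
  all (fun s => `|q.[s]| <= B) ss ->
  pnorm 1 q <= B * (8 / h) ^+ size ss.
Proof.
move=> h0 h1; elim: ss q B => [|s ss IH] q B B0 /=.
  by rewrite leqn0 size_poly_eq0 => /eqP-> _ _ _; rewrite pnorm0 expr0 mulr1.
move=> sq /andP[ps pss] /andP[s2 ss2] /andP[qs qss].
have /factor_theorem[q' qE] : root (q - q.[s]%:P) s.
  by rewrite /root hornerD hornerN hornerC subrr.
have qE1 : q = q' * ('X - s%:P) + q.[s]%:P by rewrite -qE subrK.
have sq' : (size q' <= size ss)%N.
  have [->|q'0] := eqVneq q' 0; first by rewrite size_poly0.
  have : (size (q' * ('X - s%:P))%R <= (size ss).+1)%N.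
    rewrite -qE (leq_trans (size_polyD _ _)) // geq_max sq size_polyN.
    by rewrite (leq_trans (size_polyC_leq1 _)).
  by rewrite size_Mmonic ?monicXsubC // size_XsubC addnC.
have IH' : pnorm 1 q' <= (2 * B / h) * (8 / h) ^+ size ss.
  apply: IH => //; first by rewrite divr_ge0 // ?mulr_ge0 // ltW.
  apply/allP => u us.
  have hu : h <= `|s - u| by move/allP: ps; apply.
  have nz : 0 < `|u - s| by rewrite distrC (lt_le_trans h0).
  have /= Bu := allP qss _ us.
  have E : q'.[u] * (u - s) = q.[u] - q.[s].
    by rewrite {1}qE1 !(hornerM, hornerD, hornerN, hornerX, hornerC) addrK.
  rewrite ler_pdivlMr //.
  have := congr1 (fun x => `|x|) E; rewrite normrM => E'.
  apply: (@le_trans _ _ (`|q'.[u]| * `|u - s|)).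
    by rewrite ler_wpM2l // distrC.
  by rewrite E' (le_trans (ler_normB _ _)) //; lra.
rewrite qE1 (le_trans (pnormD _ _ _)) // pnormC.
have hX : pnorm 1 ('X - s%:P) <= 3.
  have := pnorm_MXaddC 1 1 (- s).
  rewrite mul1r -polyC1 pnormC normr1 normrN polyCN => ->; lra.
have h2 : pnorm 1 (q' * ('X - s%:P)) <= (2 * B / h) * (8 / h) ^+ size ss * 3.
  by rewrite (le_trans (pnormM _ _ _)) // ler_pM // pnorm_ge0.
have h8 : 8 <= 8 / h by rewrite ler_pdivlMr //; nra.
have p1 : 1 <= (8 / h) ^+ size ss by rewrite exprn_ege1 //; lra.
apply: (le_trans (lerD h2 qs)).
rewrite exprS.
(* The norm bound 3 for ['X - s%:P] times [2 * B / h] gives [6 * B / h]; the constant term [q.[s]]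
   takes the remaining 2 of the 8. *)
have hB : B <= 2 * B / h * (8 / h) ^+ size ss.
  have b1 : B <= 2 * B / h by rewrite ler_pdivlMr //; nra.
  by rewrite (le_trans b1) // ler_peMr // (le_trans B0).
apply: (le_trans (lerD (lexx _) hB)).
by rewrite le_eqVlt; apply/orP; left; apply/eqP; field; rewrite gt_eqF.
Qed.
End PolyNorm.

(** * Interpolation at equispaced nodes and comparison of two polynomials with many roots *)

Section TwoPoints.
Variable R : realType.
Implicit Types (a c : nat -> R) (p q : {poly R}).

(** The spacing [lam / k] is the [h] of the interpolation bound; [|s0|] and [lam] being at most 1
    keeps the nodes in [|s| <= 2]. *)
Lemma pnorm1_equispaced (lam s0 B : R) (k : nat) q :
  (0 < k)%N -> 0 < lam -> lam <= 1 -> `|s0| <= 1 -> 0 <= B ->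
  (size q <= k)%N -> (forall t, 0 <= t <= lam -> `|q.[s0 + t]| <= B) ->
  pnorm 1 q <= B * (8 * k%:R / lam) ^+ k.
Proof.
move=> k0 lam0 lam1 s01 B0 sq qB.
have k0' : 0 < k%:R :> R by rewrite ltr0n.
have k1' : 1 <= k%:R :> R by rewrite ler1n.
pose ss := [seq s0 + i%:R * (lam / k%:R) | i <- iota 0 k].
have sss : size ss = k by rewrite size_map size_iota.
have h0 : 0 < lam / k%:R by rewrite divr_gt0.
have -> : 8 * k%:R / lam = 8 / (lam / k%:R) by rewrite invf_div mulrA.
have tP i : i \in iota 0 k -> 0 <= i%:R * (lam / k%:R) <= lam.
  rewrite mem_iota /= add0n => ik; rewrite mulr_ge0 ?(ltW h0) //=.
  rewrite mulrA ler_pdivrMr // mulrC ler_wpM2l ?(ltW lam0) // ler_nat.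
  exact: ltnW.
rewrite -{2}sss; apply: pnorm1_interpolation; rewrite ?sss //.
- by rewrite ler_pdivrMr // mul1r (le_trans lam1).
- rewrite pairwise_map.
  apply: (@sub_pairwise _ ltn); last first.
    by rewrite -sorted_pairwise ?iota_ltn_sorted //; exact: ltn_trans.
  move=> i j ij /=.
  rewrite opprD addrACA subrr add0r -mulrBl normrM (gtr0_norm h0) ler_peMl ?(ltW h0) //.
  have : i%:R + 1 <= j%:R :> R by rewrite natr1 ler_nat.
  by move=> ?; rewrite ler0_norm; lra.
- apply/allP => _ /mapP[i /tP/andP[t0 tl] ->].
  by rewrite (le_trans (ler_normD _ _)) // (ger0_norm t0); lra.
- by apply/allP => _ /mapP[i /tP ti ->]; exact: qB.
Qed.

(** The window part is the first sum minus the second minus the difference outside the window. The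
    two sums are small because of their roots, the last part because its coefficients nearly agree;
    these three contributions make the 3. *)
Lemma two_points_small (n : nat) (phi : nat -> {poly R}) (W : pred nat)
    (lam H M delta : R) a a' (rs rs' : seq R) :
  0 < lam -> 0 <= H -> 0 <= M ->
  (forall j, (j <= n)%N -> pnorm (9 * lam) (phi j) <= H) ->
  (forall j, (j <= n)%N -> `|a j| <= M) ->
  (forall j, (j <= n)%N -> `|a' j| <= M) ->
  (forall j, (j <= n)%N -> ~~ W j -> `|a j - a' j| <= M * delta) ->
  all (fun r => `|r| <= lam) rs -> all (fun r => `|r| <= lam) rs' ->
  (4^-1) ^+ size rs <= delta -> (4^-1) ^+ size rs' <= delta ->
  \prod_(r <- rs) ('X - r%:P) %| \sum_(j < n.+1) a j *: phi j ->
  \prod_(r <- rs') ('X - r%:P) %| \sum_(j < n.+1) a' j *: phi j ->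
  forall t, `|t| <= lam ->
    `|(\sum_(j < n.+1 | W j) (a j - a' j) *: phi j).[t]|
      <= 3 * delta * M * n.+1%:R * H.
Proof.
move=> lam0 H0 M0 phiH aM a'M aa' rsP rs'P sd sd' dv dv' t tlam.
have d0 : 0 <= delta by rewrite (le_trans _ sd) // exprn_ge0 // invr_ge0.
have tau0 : 0 <= 9 * lam by rewrite mulr_ge0 // ltW.
(* The radius [9 * lam] is chosen so that each root gains exactly [4^-1]. *)
have ratio : 2 * lam / (9 * lam - lam) = 4^-1 :> R.
  have -> : 9 * lam - lam = 8 * lam by ring.
  by field; rewrite ?lt0r_neq0.
have bnd b (us : seq R) : (forall j, (j <= n)%N -> `|b j| <= M) ->
    all (fun r => `|r| <= lam) us -> (4^-1) ^+ size us <= delta ->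
    \prod_(r <- us) ('X - r%:P) %| \sum_(j < n.+1) b j *: phi j ->
    `|(\sum_(j < n.+1) b j *: phi j).[t]| <= delta * (M * n.+1%:R * H).
  move=> bM usP sdu dvu.
  have ltl : lam < 9 * lam by lra.
  have := horner_le_roots (ltW lam0) ltl usP tlam dvu.
  rewrite ratio => /le_trans; apply; apply: ler_pM => //.
  - exact: pnorm_ge0.
  rewrite (le_trans (pnorm_sum _ _ _ tau0)) //.
  have -> : M * n.+1%:R * H = \sum_(j < n.+1) (M * H).
    by rewrite sumr_const card_ord -[in RHS]mulr_natr mulrAC.
  apply: ler_sum => j _; rewrite pnormZ ler_pM ?pnorm_ge0 //.
    by rewrite bM // -ltnS.
  by rewrite phiH // -ltnS.
have bndW : `|(\sum_(j < n.+1 | ~~ W j) (a j - a' j) *: phi j).[t]|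
    <= delta * (M * n.+1%:R * H).
  rewrite (le_trans (horner_le_pnorm _ (_ : `|t| <= 9 * lam))) //; first by lra.
  rewrite (le_trans (pnorm_sum _ _ _ tau0)) //.
  have -> : delta * (M * n.+1%:R * H) = \sum_(j < n.+1) (M * delta * H).
    by rewrite sumr_const card_ord -mulr_natr; ring.
  rewrite big_mkcond /=; apply: ler_sum => j _.
  have jn : (j <= n)%N by rewrite -ltnS.
  case: ifP => Wj; last by rewrite !mulr_ge0.
  by rewrite pnormZ ler_pM ?pnorm_ge0 ?aa' ?phiH.
have E : \sum_(j < n.+1 | W j) (a j - a' j) *: phi j =
    \sum_(j < n.+1) a j *: phi j - \sum_(j < n.+1) a' j *: phi j
    - \sum_(j < n.+1 | ~~ W j) (a j - a' j) *: phi j.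
  rewrite -sumrB.
  have -> : \sum_(j < n.+1) (a j *: phi j - a' j *: phi j) =
      \sum_(j < n.+1) (a j - a' j) *: phi j.
    by apply: eq_bigr => j _; rewrite scalerBl.
  by rewrite [X in _ = X - _](bigID (fun j : 'I_n.+1 => W j)) /= addrK.
rewrite E !(hornerD, hornerN).
have b1 := bnd _ _ aM rsP sd dv; have b2 := bnd _ _ a'M rs'P sd' dv'.
rewrite (le_trans (ler_normB _ _)) //.
have := ler_normB (\sum_(j < n.+1) a j *: phi j).[t] (\sum_(j < n.+1) a' j *: phi j).[t].
by lra.
Qed.
End TwoPoints.

(** * Gaussian decay of log-concave sequences away from their maximum *)

Section LogConcave.
Variable R : realType.
Implicit Types (a b c g : nat -> R).

(** The first ratio of consecutive terms is at most 1 and each later one gains a factor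
    [expR (- kappa)], so the exponents 0, 1, ..., m - 1 add up to ['C(m, 2)]. *)
Lemma logconcave_decay kappa g N :
  (forall i, (i <= N)%N -> 0 < g i) ->
  (forall i, (i.+2 <= N)%N -> g i.+2 * g i <= expR (- kappa) * g i.+1 ^+ 2) ->
  ((1 <= N)%N -> g 1%N <= g 0%N) ->
  forall m, (m <= N)%N -> g m <= g 0%N * expR (- kappa * 'C(m, 2)%:R).
Proof.
move=> g0 gc g1.
have step i : (i.+1 <= N)%N -> g i.+1 <= expR (- kappa * i%:R) * g i.
  elim: i => [|i IH] iN; first by rewrite mulr0 expR0 mul1r g1.
  have i1 := IH (ltnW iN).
  have p1 : 0 < g i.+1 by rewrite g0 // ltnW.
  have p0 : 0 < g i by rewrite g0 // ltnW // ltnW.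
  rewrite -(ler_pM2r p0) (le_trans (gc _ iN)) //.
  rewrite -natr1 mulrDr mulr1 expRD expr2.
  rewrite [leRHS](_ : _ =
    (expR (- kappa) * g i.+1) * (expR (- kappa * i%:R) * g i)); last by ring.
  by rewrite mulrA ler_wpM2l // mulr_ge0 ?expR_ge0 // ltW.
elim=> [|m IH] mN; first by rewrite bin0n /= mulr0 expR0 mulr1.
rewrite (le_trans (step _ mN)) //.
rewrite binS bin1 natrD mulrDr expRD mulrA [leRHS]mulrC.
by rewrite ler_wpM2l ?expR_ge0 // IH // ltnW.
Qed.

(** The decay runs to the right of the peak and, after reversing the sequence, to the left. With
    truncated subtraction [(j - J) + (J - j)] is the distance between the indices. *)
Lemma logconcave_peak kappa b n J :
  (forall j, (j <= n)%N -> 0 < b j) ->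
  (forall j, (j.+2 <= n)%N -> b j.+2 * b j <= expR (- kappa) * b j.+1 ^+ 2) ->
  (J <= n)%N -> (forall j, (j <= n)%N -> b j <= b J) ->
  forall j, (j <= n)%N ->
    b j <= b J * expR (- kappa * 'C((j - J) + (J - j), 2)%:R).
Proof.
move=> b0 bc Jn bJ j jn.
have [jJ|Jj] := leqP j J.
  have -> : (j - J + (J - j) = J - j)%N by lia.
  have := @logconcave_decay kappa (fun i => b (J - i)%N) J.
  rewrite subn0 => /(_ _ _ _ (J - j)%N (leq_subr _ _)); rewrite subKn //.
  apply.
  - by move=> i _; rewrite b0 // (leq_trans (leq_subr _ _)).
  - move=> i iJ; have := bc (J - i.+2)%N.
    have -> : ((J - i.+2).+2 = J - i)%N by lia.
    have -> : ((J - i.+2).+1 = J - i.+1)%N by lia.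
    by move=> h; rewrite mulrC h // (leq_trans (leq_subr _ _)).
  - by move=> _; rewrite bJ // (leq_trans (leq_subr _ _)).
have -> : (j - J + (J - j) = j - J)%N by lia.
have := @logconcave_decay kappa (fun i => b (J + i)%N) (n - J)%N.
rewrite addn0 => /(_ _ _ _ (j - J)%N).
rewrite (subnKC (ltnW Jj)); apply.
- by move=> i iJ; rewrite b0 //; lia.
- by move=> i iJ; have := bc (J + i)%N; rewrite !addnS; apply; lia.
- by move=> h; rewrite bJ //; lia.
- by lia.
Qed.

Lemma ratio_bound b n r i j : 1 <= r ->
  (forall j, (j <= n)%N -> 0 < b j) ->
  (forall j, (j < n)%N -> b j.+1 <= r * b j) ->
  (forall j, (j < n)%N -> b j <= r * b j.+1) ->
  (i <= n)%N -> (j <= n)%N -> b i <= r ^+ (i - j + (j - i)) * b j.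
Proof.
move=> r1 b0 up dn.
have r0 : 0 <= r by lra.
have U m k : (k + m <= n)%N -> b (k + m)%N <= r ^+ m * b k.
  elim: m => [|m IH]; first by rewrite addn0 expr0 mul1r.
  rewrite addnS => h; rewrite (le_trans (up _ h)) // exprS -mulrA ler_wpM2l //.
  by rewrite IH // ltnW.
have D m k : (k + m <= n)%N -> b k <= r ^+ m * b (k + m)%N.
  elim: m => [|m IH]; first by rewrite addn0 expr0 mul1r.
  rewrite addnS => h; rewrite (le_trans (IH (ltnW h))) // exprSr -mulrA.
  by rewrite ler_wpM2l ?exprn_ge0 // dn.
move=> iN jN; have [ij|ji] := leqP i j.
  have -> : (i - j + (j - i) = j - i)%N by lia.
  by have := @D (j - i)%N i; rewrite subnKC //; apply.
have -> : (i - j + (j - i) = i - j)%N by lia.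
by have := @U (i - j)%N j; rewrite subnKC ?(ltnW ji) //; apply.
Qed.

Lemma exists_argmax b n : exists2 J, (J <= n)%N & forall j, (j <= n)%N -> b j <= b J.
Proof.
have [J _ H] := @arg_maxP _ _ _ (ord0 : 'I_n.+1) xpredT (fun i => b i) isT.
exists J; first by rewrite -ltnS.
by move=> j jn; exact: (H (Ordinal (jn : (j < n.+1)%N))).
Qed.

End LogConcave.

(** * Rigidity of the coefficients of polynomials with many roots *)

Section Windows.
Variable R : realType.
Implicit Types (a b c : nat -> R) (p q : {poly R}).

Definition weighted_poly c (n : nat) a : {poly R} := \poly_(j < n.+1) (a j * c j).

(** What the elliptic and the Weyl weights share. The last condition is log-concavity with a gain of
    order [1 / n] per step, which gives the terms at any point a Gaussian profile of width about
    [sqrt n]. *)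
Definition regular_weights (n : nat) c : Prop :=
  [/\ c 0%N = 1, forall j, (j <= n)%N -> 0 < c j,
      forall j, (j < n)%N -> c j.+1 <= c j,
      forall j, (j < n)%N -> c j <= n%:R * c j.+1 &
      forall j, (j.+2 <= n)%N ->
        c j.+2 * c j <= expR (- (2 * n%:R)^-1) * c j.+1 ^+ 2].

(* On a window of [k] indices, the coefficients are determined up to [eta] by the
   other ones as soon as the polynomial has enough roots in [I]: [size rs] roots
   are enough when [4^-1 ^+ size rs <= delta]. *)
Definition rigid_on (n : nat) c (M delta eta : R) (k : nat) (I : pred R) : Prop :=
  exists2 j1, (j1 + k <= n.+1)%N & forall a a' (rs rs' : seq R),
    (forall j, (j <= n)%N -> `|a j| <= M) ->
    (forall j, (j <= n)%N -> `|a' j| <= M) ->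
    (forall j, (j <= n)%N -> ~~ (j1 <= j < j1 + k)%N -> `|a j - a' j| <= M * delta) ->
    all I rs -> all I rs' ->
    (4^-1) ^+ size rs <= delta -> (4^-1) ^+ size rs' <= delta ->
    \prod_(r <- rs) ('X - r%:P) %| weighted_poly c n a ->
    \prod_(r <- rs') ('X - r%:P) %| weighted_poly c n a' ->
    forall j, (j1 <= j < j1 + k)%N -> `|a j - a' j| <= eta.

Lemma window_big (V : Type) (idx : V) (op : Monoid.law idx) (F : nat -> V) (n k j1 : nat) :
  (j1 + k <= n.+1)%N ->
  \big[op/idx]_(j < n.+1 | (j1 <= j < j1 + k)%N) F j = \big[op/idx]_(i < k) F (j1 + i)%N.
Proof.
move=> h.
have -> : \big[op/idx]_(i < k) F (j1 + i)%N = \big[op/idx]_(j1 <= i < j1 + k) F i.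
  rewrite -{2}[j1]add0n big_addn addKn big_mkord.
  by apply: eq_bigr => i _; rewrite addnC.
rewrite (big_nat_widen _ _ _ _ _ h) (big_nat_widenl _ _ _ _ _ (leq0n j1)) big_mkord.
by apply: eq_bigl => i; lia.
Qed.

Lemma window_coef_bound (k : nat) (lam s0 B : R) (u : nat -> R) :
  (0 < k)%N -> 0 < lam -> lam <= 1 -> `|s0| <= 1 -> 0 <= B ->
  (forall t, 0 <= t <= lam -> `|\sum_(i < k) u i * (s0 + t) ^+ i| <= B) ->
  forall i, (i < k)%N -> `|u i| <= B * (8 * k%:R / lam) ^+ k.
Proof.
move=> k0 l0 l1 s01 B0 H i ik.
have := coef_le_pnorm1 (\poly_(i < k) u i) i; rewrite coef_poly ik => /le_trans; apply.
apply: (pnorm1_equispaced k0 l0 l1 s01 B0 (size_poly _ _)) => t tl.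
by rewrite horner_poly H.
Qed.

Lemma weighted_poly_sum c n a :
  weighted_poly c n a = \sum_(j < n.+1) a j *: (c j *: 'X^j).
Proof. by rewrite /weighted_poly poly_def; apply: eq_bigr => j _; rewrite scalerA. Qed.

(** The window is the first [k] indices. At radius [9 * 9^-1 = 1] every basis term has norm
    [c j <= 1], so the origin itself can be the centre. The numerical condition is written with
    [lam] to match the one for far windows. *)
Lemma rigid_near0 (n k : nat) c (M delta eta r lam : R) :
  regular_weights n c -> (0 < k)%N -> (k <= n.+1)%N -> n%:R <= r -> 1 <= r ->
  0 <= M -> 0 <= delta -> 0 < lam -> lam <= 9^-1 ->
  3 * delta * M * n.+1%:R * (16 * k%:R * r / lam) ^+ k <= eta ->
  rigid_on n c M delta eta k (fun x => `|x| <= 9^-1).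
Proof.
move=> [c01 c0 cd cu cc] k0 kn nr r1 M0 d0 l0 l9 req.
exists 0%N; first by rewrite add0n.
move=> a a' rs rs' aM a'M aa' rsI rs'I sd sd' dv dv' j /andP[_]; rewrite add0n => jk.
have jn : (j <= n)%N by rewrite -ltnS (leq_trans jk).
have c1 i : (i <= n)%N -> c i <= 1.
  elim: i => [|i IH] iN; first by rewrite c01.
  by rewrite (le_trans (cd _ iN)) // IH // ltnW.
have i9 : 0 < 9^-1 :> R by rewrite invr_gt0.
have T0 := @two_points_small R n (fun j => c j *: 'X^j) (fun j => 0 <= j < 0 + k)%N 9^-1 1 M
  delta a a' rs rs' i9 ler01 M0.
have T t : `|t| <= 9^-1 ->
   `|\sum_(i < k) ((a i - a' i) * c i) * (0 + t) ^+ i| <= 3 * delta * M * n.+1%:R.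
  move=> t9.
  have := fun H => T0 H aM a'M aa' rsI rs'I sd sd'.
  rewrite -!weighted_poly_sum mulr1 => /(_ _ dv dv' t t9).
  have -> : (\sum_(j0 < n.+1 | (0 <= j0 < 0 + k)%N)
     (a j0 - a' j0) *: (c j0 *: 'X^j0)).[t] =
     \sum_(i < k) ((a i - a' i) * c i) * (0 + t) ^+ i.
    rewrite (window_big _ (fun j => (a j - a' j) *: (c j *: 'X^j))) ?add0n //.
    rewrite horner_sum; apply: eq_bigr => i _.
    by rewrite !hornerZ hornerXn mulrA add0r add0n.
  apply=> i iN; rewrite pnormZ gtr0_norm ?c0 //.
  have e9 : 9 / 9 = 1 :> R by field.
  by rewrite pnormXn e9 expr1n mulr1; exact: c1.
have B0 : 0 <= 3 * delta * M * n.+1%:R by rewrite !mulr_ge0.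
have l1 : 9^-1 <= 1 :> R by rewrite invf_le1 // ler1n.
have n01 : `|0 : R| <= 1 by rewrite normr0.
have C := window_coef_bound k0 i9 l1 n01 B0 _ jk.
have {C} := C (fun i => (a i - a' i) * c i).
rewrite normrM => C.
have r0 : 0 <= r := le_trans ler01 r1.
have K0 : 0 <= 8 * k%:R / 9^-1 :> R.
  by rewrite divr_ge0 ?mulr_ge0 ?invr_ge0.
(* From [c 0 = 1], each index loses at most a factor [r]; this turns a bound for
   [(a j - a' j) * c j] into one for [a j - a' j]. *)
have cj : 1 <= r ^+ k * c j.
  have /= := @ratio_bound _ c n r 0 j r1 c0 _ _ (leq0n _) jn.
  rewrite c01 sub0n subn0 add0n => h.
  apply: (le_trans (h _ _)) => [i iN|i iN|].
  - by rewrite (le_trans (cd _ iN)) // ler_peMl // ltW // c0 // ltnW.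
  - by rewrite (le_trans (cu _ iN)) // ler_wpM2r // ltW // c0.
  - by rewrite ler_wpM2r ?(ltW (c0 _ jn)) // ler_weXn2l // ltnW.
have {}C : `|a j - a' j| * `|c j| <= 3 * delta * M * n.+1%:R * (8 * k%:R / 9^-1) ^+ k.
  by apply: C => t /andP[t0 tl]; rewrite T // ger0_norm.
apply: le_trans req.
apply: (@le_trans _ _ (`|a j - a' j| * `|c j| * r ^+ k)).
  by rewrite -mulrA ler_peMr // gtr0_norm ?c0 // mulrC.
apply: (le_trans (ler_wpM2r (exprn_ge0 _ r0) C)).
rewrite -[leLHS]mulrA -exprMn ler_wpM2l //.
have i_lam : 9 <= lam^-1 by rewrite -[9]invrK lef_pV2 ?posrE.
have kr0 : 0 <= k%:R * r by rewrite mulr_ge0.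
rewrite lerXn2r ?nnegrE ?mulr_ge0 ?invr_ge0 ?(ltW l0) //.
have -> : 8 * k%:R / 9^-1 * r = 16 * (k%:R * r) * (9 / 2) by field.
have -> : 16 * k%:R * r / lam = 16 * (k%:R * r) / lam by rewrite !mulrA.
by rewrite ler_wpM2l ?mulr_ge0 //; lra.
Qed.

(** At most [n] pairs of factors combine into [1 - 'X ^+ 2], of norm at most [1 + tau ^+ 2]; only
    the unpaired factors, as many as the distance from [j] to [J], cost [expR tau] each. This is
    what [(1 - 'X) ^+ J] buys. *)
Lemma pnorm_window_basis (tau : R) (n J j : nat) : 0 <= tau ->
  (J <= n)%N -> (j <= n)%N ->
  pnorm tau ((1 - 'X) ^+ J * (1 + 'X) ^+ j)
    <= expR (n%:R * tau ^+ 2 + ((j - J) + (J - j))%:R * tau).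
Proof.
move=> t0 Jn jn.
have X1 : pnorm tau (1 + 'X) <= 1 + tau.
  by rewrite (le_trans (pnormD _ _ t0)) // -polyC1 pnormC -['X]expr1 pnormXn normr1 expr1.
have X2 : pnorm tau (1 - 'X) <= 1 + tau.
  rewrite (le_trans (pnormD _ _ t0)) // -polyC1 pnormC -['X]expr1 -scaleN1r pnormZ pnormXn.
  by rewrite normrN normr1 expr1 mul1r.
have X3 : pnorm tau (1 - 'X ^+ 2) <= 1 + tau ^+ 2.
  rewrite (le_trans (pnormD _ _ t0)) // -polyC1 pnormC -scaleN1r pnormZ pnormXn.
  by rewrite normrN normr1 mul1r.
have main p i m : pnorm tau p <= 1 + tau -> (i <= n)%N ->
    pnorm tau ((1 - 'X ^+ 2) ^+ i * p ^+ m) <= expR (n%:R * tau ^+ 2 + m%:R * tau).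
  move=> hp iN; rewrite (le_trans (pnormM _ _ t0)) // expRD.
  have t20 : 0 <= tau ^+ 2 by rewrite exprn_ge0.
  apply: ler_pM; rewrite ?pnorm_ge0 //.
    rewrite (le_trans (pnormX _ _ t0)) // (@le_trans _ _ (expR (tau ^+ 2) ^+ i)) //.
      by rewrite lerXn2r ?nnegrE ?pnorm_ge0 ?expR_ge0 // (le_trans X3) // expR_ge1Dx.
    by rewrite -expRM_natl ler_expR ler_wpM2r // ler_nat.
  rewrite (le_trans (pnormX _ _ t0)) // (@le_trans _ _ (expR tau ^+ m)) //.
    by rewrite lerXn2r ?nnegrE ?pnorm_ge0 ?expR_ge0 // (le_trans hp) // expR_ge1Dx.
  by rewrite -expRM_natl.
have E : (1 - 'X) * (1 + 'X) = 1 - 'X ^+ 2 :> {poly R} by ring.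
have [jJ|Jj] := leqP j J.
  have -> : (j - J + (J - j) = J - j)%N by lia.
  rewrite -{1}(subnK jJ) exprD -mulrA -exprMn E mulrC.
  exact: main.
have -> : (j - J + (J - j) = j - J)%N by lia.
rewrite -{1}(subnKC (ltnW Jj)) exprD mulrA -exprMn E.
exact: main.
Qed.

Lemma prod_XsubC_comp (x0 : R) (rs : seq R) : x0 != 0 ->
  (\prod_(r <- rs) ('X - r%:P)) \Po (x0 *: (1 + 'X)) =
  x0 ^+ size rs *: \prod_(t <- [seq r / x0 - 1 | r <- rs]) ('X - t%:P).
Proof.
move=> x00; elim: rs => [|r rs IH] /=; first by rewrite !big_nil expr0 scale1r comp_polyC.
rewrite !big_cons comp_polyM IH comp_polyB comp_polyX comp_polyC.
have -> : x0 *: (1 + 'X) - r%:P = x0 *: ('X - (r / x0 - 1)%:P).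
  rewrite -!mul_polyC mulrBr -polyCM mulrBr mulr1 mulrCA divff // mulr1 polyCB.
  by ring.
by rewrite -scalerAl -scalerAr scalerA exprS.
Qed.

Lemma window_poly_comp c n a x0 J :
  (1 - 'X) ^+ J * (weighted_poly c n a \Po (x0 *: (1 + 'X))) =
  \sum_(j < n.+1) a j *: ((c j * x0 ^+ j) *: ((1 - 'X) ^+ J * (1 + 'X) ^+ j)).
Proof.
rewrite weighted_poly_sum raddf_sum mulr_sumr; apply: eq_bigr => j _ /=.
by rewrite !comp_polyZ comp_Xn_poly exprZn -!scalerAr !scalerA mulrA.
Qed.
Lemma natr_bin2 m : 'C(m, 2)%:R = m%:R * (m%:R - 1) / 2 :> R.
Proof.
elim: m => [|m IH]; first by rewrite bin0n mul0r mul0r.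
by rewrite binS bin1 natrD IH -natr1; field.
Qed.

(** Completing the square in [m]: the Gaussian decay beats the linear growth [m * tau] up to
    [n * tau ^+ 2], and the 1 absorbs the gap between [m ^ 2] and [m * (m - 1)]. *)
Lemma window_exponent (n m : nat) (tau : R) : (0 < n)%N -> (m <= n)%N ->
  - (2 * n%:R)^-1 * 'C(m, 2)%:R + (n%:R * tau ^+ 2 + m%:R * tau)
    <= 2 * (n%:R * tau ^+ 2) + 1.
Proof.
move=> n0 mn; rewrite natr_bin2.
have N0 : 0 < n%:R :> R by rewrite ltr0n.
have MN : m%:R <= n%:R :> R by rewrite ler_nat.
move: (n%:R : R) (m%:R : R) N0 MN => N m' N0 MN.
have sq : 0 <= (2 * N * tau - m') ^+ 2 / (4 * N).
  by rewrite divr_ge0 ?sqr_ge0 // mulr_ge0 // ltW.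
have lin : m' / (4 * N) <= 1 by rewrite ler_pdivrMr ?mul1r; nra.
suff -> : - (2 * N)^-1 * (m' * (m' - 1) / 2) + (N * tau ^+ 2 + m' * tau) =
  2 * (N * tau ^+ 2) + m' / (4 * N) - (2 * N * tau - m') ^+ 2 / (4 * N) by lra.
by field; rewrite gt_eqF.
Qed.

(** Allows the common factor to be divided out: each of the [j1] pairs [1 - t ^+ 2] is at least
    [expR (- (2 * lam ^+ 2))], and the at most [k] unpaired factors [1 - t] exceed [2^-1]. *)
Lemma window_factor_ge (n J j1 k : nat) (lam t : R) : 0 <= lam -> lam <= 9^-1 ->
  `|t| <= lam -> (j1 <= n)%N -> (j1 <= J <= j1 + k)%N ->
  expR (- (2 * (n%:R * lam ^+ 2))) * (2^-1) ^+ k <= (1 - t) ^+ J * (1 + t) ^+ j1.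
Proof.
move=> l0 l9 tl j1n /andP[j1J Jk].
have l9' : lam * 9 <= 1 by rewrite -ler_pdivlMr ?div1r.
have tlo : - lam <= t <= lam by rewrite -ler_norml.
rewrite -{1}(subnK j1J) exprD -mulrA -exprMn mulrC.
apply: ler_pM; rewrite ?expR_ge0 ?exprn_ge0 ?invr_ge0 //.
  apply: (@le_trans _ _ (2^-1 ^+ (J - j1))).
    rewrite ler_wiXn2l ?invr_ge0 //; [lra | lia].
  by rewrite lerXn2r ?nnegrE; lra.
have e1 : expR (- (2 * lam ^+ 2)) <= (1 - t) * (1 + t).
  have t2 : t ^+ 2 <= lam ^+ 2 by rewrite -[t ^+ 2]real_normK ?num_real // lerXn2r ?nnegrE.
  have lsq : lam ^+ 2 <= 2^-1 by rewrite expr2; nra.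
  rewrite expRN -[leLHS]mul1r ler_pdivrMr ?expR_gt0 //.
  apply: (@le_trans _ _ ((1 - lam ^+ 2) * (1 + 2 * lam ^+ 2))).
    have := sqr_ge0 lam; nra.
  apply: ler_pM; rewrite ?expR_ge1Dx //; have := sqr_ge0 lam; nra.
apply: (@le_trans _ _ (expR (- (2 * lam ^+ 2)) ^+ j1)).
  rewrite -expRM_natl ler_expR mulrN lerN2 mulrCA ler_wpM2l //.
  by rewrite ler_wpM2r ?exprn_ge0 // ler_nat.
by rewrite lerXn2r ?nnegrE ?expR_ge0 // (le_trans (expR_ge0 _) e1).
Qed.
Lemma window_position (n k J : nat) : (0 < k)%N -> (k <= n.+1)%N -> (J <= n)%N ->
  exists j1, [/\ (j1 <= n)%N, (j1 <= J < j1 + k)%N & (j1 + k <= n.+1)%N].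
Proof. by move=> k0 kn Jn; exists (minn J (n.+1 - k)); split; lia. Qed.

Lemma absdiff_leq (m i j : nat) : (i <= m)%N -> (j <= m)%N -> (i - j + (j - i) <= m)%N.
Proof. by lia. Qed.

Lemma absdiff_window (j1 k i j : nat) : (j1 <= i < j1 + k)%N -> (j1 <= j < j1 + k)%N ->
  (i - j + (j - i) <= k)%N.
Proof. by lia. Qed.

Lemma horner_basis (J i : nat) (t : R) :
  ((1 - 'X) ^+ J * (1 + 'X) ^+ i).[t] = (1 - t) ^+ J * (1 + t) ^+ i.
Proof. by rewrite !hornerE. Qed.

Lemma rigid_far (n k : nat) c (M delta eta r lam x0 : R) :
  regular_weights n c -> (0 < n)%N -> (0 < k)%N -> (k <= n.+1)%N ->
  x0 != 0 -> `|x0| <= r -> n%:R <= r * `|x0| -> 1 <= r ->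
  0 <= M -> 0 <= delta -> 0 < lam -> lam <= 9^-1 ->
  3 * delta * M * n.+1%:R * expR (164 * (n%:R * lam ^+ 2) + 1) *
    (16 * k%:R * r / lam) ^+ k <= eta ->
  rigid_on n c M delta eta k (fun x => `|x - x0| <= lam * `|x0|).
Proof.
move=> [c01 c0 cd cu cc] n0 k0 kn x00 x0r nrx r1 M0 d0 l0 l9 req.
have ax0 : 0 < `|x0| by rewrite normr_gt0.
have r0 : 0 <= r := le_trans ler01 r1.
(* Moduli of the basis terms at [x0]; they inherit log-concavity from [c], since the powers of
   [|x0|] are geometric. *)
pose b j := c j * `|x0| ^+ j.
have b0 j : (j <= n)%N -> 0 < b j.
  by move=> jn; rewrite mulr_gt0 ?c0 // exprn_gt0.
have bE j : (j <= n)%N -> `|c j * x0 ^+ j| = b j.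
  by move=> jn; rewrite normrM normrX gtr0_norm ?c0.
have [J Jn bJ] := exists_argmax b n.
have [j1 [j1n JW j1k]] := window_position k0 kn Jn.
have j1J : (j1 <= J <= j1 + k)%N by case/andP: JW => -> /ltnW.
exists j1 => // a a' rs rs' aM a'M aa' rsI rs'I sd sd' dv dv' j jW.
pose phi i : {poly R} := (c i * x0 ^+ i) *: ((1 - 'X) ^+ J * (1 + 'X) ^+ i).
set E := n%:R * lam ^+ 2 in req.
(* [162 = 2 * 9 ^ 2] comes from [window_exponent] at radius [9 * lam]; dividing out the common
   factor adds 2 more, whence 164. *)
pose H := b J * expR (162 * E + 1).
have H0 : 0 <= H by rewrite mulr_ge0 ?expR_ge0 // ltW // b0.
have tau0 : 0 <= 9 * lam by rewrite mulr_ge0 // ltW.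
have phiH i : (i <= n)%N -> pnorm (9 * lam) (phi i) <= H.
  move=> iN; rewrite pnormZ bE //.
  have h1 := @logconcave_peak _ (2 * n%:R)^-1 b n J b0 _ Jn bJ i iN.
  have {}h1 : b i <= b J * expR (- (2 * n%:R)^-1 * 'C(i - J + (J - i), 2)%:R).
    apply: h1 => m mn; rewrite /b.
    have -> : c m.+2 * `|x0| ^+ m.+2 * (c m * `|x0| ^+ m) =
       (c m.+2 * c m) * (`|x0| ^+ m.+1) ^+ 2 by rewrite !exprS; ring.
    by rewrite exprMn [leRHS]mulrA ler_wpM2r ?cc //.
  have h2 := pnorm_window_basis tau0 Jn iN.
  rewrite (le_trans (ler_pM _ _ h1 h2)) ?pnorm_ge0 ?(ltW (b0 _ iN)) //.
  rewrite -mulrA -expRD /H ler_wpM2l ?(ltW (b0 _ Jn)) // ler_expR.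
  apply: (le_trans (window_exponent _ n0 _)); first exact: absdiff_leq.
  by rewrite /E exprMn; lra.
have scaled us : all (fun x => `|x - x0| <= lam * `|x0|) us ->
    all (fun x => `|x| <= lam) [seq x / x0 - 1 | x <- us].
  move=> /allP h; apply/allP => _ /mapP[x xs ->].
  have -> : x / x0 - 1 = (x - x0) / x0 by rewrite mulrBl divff.
  by rewrite normrM normfV ler_pdivrMr // h.
have roots d us : \prod_(x <- us) ('X - x%:P) %| weighted_poly c n d ->
    \prod_(x <- [seq x / x0 - 1 | x <- us]) ('X - x%:P)
      %| \sum_(i < n.+1) d i *: phi i.
  move=> /(dvdp_comp_poly (x0 *: (1 + 'X))).
  rewrite prod_XsubC_comp // dvdpZl ?expf_neq0 // => h.
  by rewrite /phi -window_poly_comp dvdp_mull.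
(* Once [(1 - t) ^+ J * (1 + t) ^+ j1] is divided out, a polynomial of degree below [k] in [1 + t]
   remains, and interpolation near 1 controls its coefficients. *)
pose u i := (a (j1 + i)%N - a' (j1 + i)%N) * (c (j1 + i)%N * x0 ^+ (j1 + i)).
pose S t := \sum_(i < k) u i * (1 + t) ^+ i.
pose B := 3 * delta * M * n.+1%:R * H * (expR (2 * E) * 2 ^+ k).
have SB t : 0 <= t <= lam -> `|S t| <= B.
  move=> /andP[t0 tl].
  have tl' : `|t| <= lam by rewrite ger0_norm.
  have := @two_points_small R n phi (fun i => j1 <= i < j1 + k)%N lam H M delta a a'
    _ _ l0 H0 M0 phiH aM a'M aa' (scaled _ rsI) (scaled _ rs'I).
  rewrite !size_map => /(_ sd sd' (roots _ _ dv) (roots _ _ dv') t tl').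
  rewrite (window_big _ (fun i => (a i - a' i) *: phi i)) // horner_sum.
  have -> : \sum_(i < k) ((a (j1 + i)%N - a' (j1 + i)%N) *: phi (j1 + i)%N).[t] =
      (1 - t) ^+ J * (1 + t) ^+ j1 * S t.
    rewrite /S /u mulr_sumr; apply: eq_bigr => i _.
    rewrite /phi !hornerZ horner_basis [(1 + t) ^+ (_ + _)]exprD !mulrA; congr (_ * _).
    by rewrite -[LHS]mulrA mulrC !mulrA.
  rewrite normrM => h.
  have F := window_factor_ge (ltW l0) l9 tl' j1n j1J.
  have Fp : 0 < expR (- (2 * E)) * 2^-1 ^+ k.
    by rewrite mulr_gt0 ?expR_gt0 // exprn_gt0 // invr_gt0.
  have -> : B = 3 * delta * M * n.+1%:R * H / (expR (- (2 * E)) * 2^-1 ^+ k).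
    by rewrite /B invfM -expRN opprK exprVn invrK.
  rewrite ler_pdivlMr // mulrC (le_trans _ h) // ler_wpM2r //.
  by rewrite (le_trans F) // ler_norm.
have B0 : 0 <= B by rewrite !mulr_ge0 ?expR_ge0 ?exprn_ge0 ?(ltW (b0 _ Jn)) ?(ltW (c0 _ Jn)).
have l1 : lam <= 1 by rewrite (le_trans l9) // invf_le1 ?ler1n.
have n1 : `|1 : R| <= 1 by rewrite normr1.
have /andP[j1j jk] := jW.
have jk' : (j - j1 < k)%N by rewrite ltn_subLR.
have jn : (j <= n)%N by rewrite -ltnS (leq_trans jk).
have := @window_coef_bound k lam 1 B u k0 l0 l1 n1 B0 SB _ jk'.
rewrite /u (subnKC j1j) normrM bE // => C.
(* The window contains the peak [J], so passing from [b J] to [b j] takes at most [k] steps, each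
   losing at most [r]. *)
have bJj : b J <= r ^+ k * b j.
  have up i : (i < n)%N -> b i.+1 <= r * b i.
    move=> iN; rewrite /b exprS mulrCA ler_pM ?mulr_ge0 ?exprn_ge0 //.
    - by rewrite ltW // c0.
    - by rewrite ler_wpM2r ?exprn_ge0 // cd.
  have dn i : (i < n)%N -> b i <= r * b i.+1.
    move=> iN; rewrite /b exprS.
    rewrite [leRHS](_ : _ = (r * `|x0|) * c i.+1 * `|x0| ^+ i); last by ring.
    rewrite ler_wpM2r ?exprn_ge0 // (le_trans (cu _ iN)) // ler_wpM2r //.
    by rewrite ltW // c0.
  rewrite (le_trans (ratio_bound r1 b0 up dn Jn jn)) //.
  by rewrite (ler_wpM2r (ltW (b0 _ jn))) // ler_weXn2l // (absdiff_window JW jW).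
rewrite -(ler_pM2r (b0 _ Jn)) (le_trans (ler_wpM2l (normr_ge0 _) bJj)) //.
rewrite mulrCA (le_trans (ler_wpM2l (exprn_ge0 _ r0) C)) //.
apply: le_trans (ler_wpM2r (ltW (b0 _ Jn)) req).
rewrite le_eqVlt; apply/orP; left; apply/eqP.
have -> : 164 * E + 1 = (162 * E + 1) + 2 * E by ring.
rewrite /B /H [expR (_ + 2 * E)]expRD.
have -> : 16 * k%:R * r / lam = r * 2 * (8 * k%:R / lam) by field; rewrite gt_eqF.
by rewrite [(r * 2 * _) ^+ k]exprMn [(r * 2) ^+ k]exprMn; ring.
Qed.
End Windows.

(** * Numerical conditions for large n *)

Section Asymptotics.
Variable R : realType.

(** [s] equals [expR (l / 2)], whose quartic Taylor term [l ^ 4 / 384] already exceeds [9 * l ^ 2]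
    for [l >= 100]. *)
Lemma ln_sqrt_bounds (n : nat) (l s : R) : l = ln n%:R -> s = Num.sqrt n%:R ->
  100 <= l ->
  [/\ 0 < s, n%:R = s ^+ 2, n%:R = expR l, l <= s & 9 * l ^+ 2 <= s].
Proof.
move=> lE sE l100.
have n0 : 0 < n%:R :> R.
  rewrite ltr0n lt0n; apply: contraTneq l100 => n0.
  by rewrite lE n0 ln0 // -ltNge.
have nE : n%:R = expR l by rewrite lE lnK // posrE.
have s2 : n%:R = s ^+ 2 by rewrite sE sqr_sqrtr // ltW.
have sexp : s = expR (l / 2).
  rewrite sE nE (_ : expR l = expR (l / 2) ^+ 2) ?sqrtr_sqr ?ger0_norm ?expR_ge0 //.
  by rewrite -expRM_natl; congr expR; field.
have l0 : 0 <= l / 2 by lra.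
have := expR_ge1Dxn 3 l0; rewrite -sexp => h.
have f4 : 4`!%:R = 24 :> R by [].
rewrite f4 in h.
have h9 : 9 * l ^+ 2 <= s.
  have h25 : 9 <= l ^+ 2 / 384.
    have -> : l ^+ 2 / 384 = (l / 20) ^+ 2 * (25 / 24) by field.
    have u5 : 5 <= l / 20 by lra.
    have : 5 * 5 <= (l / 20) ^+ 2 by rewrite expr2 ler_pM.
    lra.
  have e4 : (l / 2) ^+ 4 / 24 = l ^+ 2 / 384 * l ^+ 2 by field.
  rewrite e4 in h.
  have : 9 * l ^+ 2 <= l ^+ 2 / 384 * l ^+ 2 by rewrite ler_wpM2r // sqr_ge0.
  by move: h; clear; lra.
split=> //.
  by rewrite sexp expR_gt0.
rewrite (le_trans _ h9) // expr2 mulrA ler_peMl //; lra.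
Qed.

(** Exponents are compared. The roots give [- (A * l / 5)]; interpolation costs [6 * l * (A / 100)],
    its base being at most [n ^ 6]. The remaining [14 / 100 * l * A] pays for [A] from the
    coefficient bound, for [169 * l ^ 4] with [l ^ 4 <= A / a] (164 plus 5 for lower-order terms),
    and for [- ln eta]. *)
Lemma rigidity_condition (n k : nat) (l s A a eta lam : R) :
  100 <= l -> 0 < s -> n%:R = s ^+ 2 -> n%:R = expR l -> 9 * l ^+ 2 <= s ->
  lam = l ^+ 2 / s -> 0 < a -> 0 < eta -> a * l ^+ 4 <= A -> 1 <= A ->
  k%:R <= A / 100 -> (k <= n)%N -> (0 < k)%N ->
  1 + 169 / a + `|ln eta| <= 14 / 100 * l ->
  3 * expR (- (A * l / 5)) * expR A * n.+1%:R * expR (164 * (n%:R * lam ^+ 2) + 1) *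
    (16 * k%:R * n%:R ^+ 3 / lam) ^+ k <= eta.
Proof.
move=> l100 s0 ns ne ls lamE a0 eta0 aA A1 kA kn k0 hl.
have l0 : 0 < l by lra.
have lam_sq : n%:R * lam ^+ 2 = l ^+ 4.
  by rewrite lamE ns expr_div_n; field; rewrite gt_eqF.
have n16 : 16 <= n%:R :> R.
  by rewrite ne (le_trans _ (expR_ge1Dx _)) //; lra.
have base : 16 * k%:R * n%:R ^+ 3 / lam <= expR (6 * l).
  have lami : lam^-1 <= n%:R.
    rewrite lamE invf_div ns ler_pdivrMr ?exprn_gt0 //.
    have l21 : 1 <= l ^+ 2 by rewrite exprn_ege1 //; lra.
    have s1 : 1 <= s by lra.
    by rewrite -[leLHS]mulr1 ler_pM // ?(ltW s0) // expr2 ler_peMr // ltW.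
  have kn' : k%:R <= n%:R :> R by rewrite ler_nat.
  rewrite expRM_natl -ne.
  rewrite [leRHS](_ : _ = n%:R * n%:R * n%:R ^+ 3 * n%:R); last by rewrite !exprS expr0; ring.
  have lam0 : 0 < lam by rewrite lamE divr_gt0 // exprn_gt0.
  by rewrite !ler_pM ?mulr_ge0 ?exprn_ge0 ?invr_ge0 ?(ltW lam0).
have n1 : n.+1%:R <= expR (2 * l).
  rewrite expRM_natl -ne -natr1 expr2; nra.
have three : 3 <= expR 2 :> R by rewrite (le_trans _ (expR_ge1Dx _)) //; lra.
have pw : (16 * k%:R * n%:R ^+ 3 / lam) ^+ k <= expR (6 * l * (A / 100)).
  have lam0 : 0 < lam by rewrite lamE divr_gt0 // exprn_gt0.
  apply: (@le_trans _ _ (expR (6 * l) ^+ k)).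
    by rewrite lerXn2r ?nnegrE ?expR_ge0 // !mulr_ge0 ?exprn_ge0 // ?invr_ge0 ?(ltW lam0).
  by rewrite -expRM_natl ler_expR mulrC ler_wpM2l // mulr_ge0 // ltW.
have lam0 : 0 < lam by rewrite lamE divr_gt0 // exprn_gt0.
apply: (@le_trans _ _ (expR 2 * expR (- (A * l / 5)) * expR A * expR (2 * l) *
    expR (164 * l ^+ 4 + 1) * expR (6 * l * (A / 100)))).
  rewrite lam_sq; apply: ler_pM; rewrite ?mulr_ge0 ?expR_ge0 //.
    by rewrite exprn_ge0 // !mulr_ge0 ?exprn_ge0 ?invr_ge0 ?(ltW lam0).
  rewrite ler_wpM2r ?expR_ge0 // ler_pM ?mulr_ge0 ?expR_ge0 //.
  by rewrite ler_wpM2r ?expR_ge0 // ler_wpM2r ?expR_ge0.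
rewrite -!expRD -[leRHS]lnK ?posrE // ler_expR.
have h1 : l ^+ 4 <= A / a by rewrite ler_pdivlMr // mulrC.
have h2 : 2 * l + 3 <= 5 * l ^+ 4.
  have l3 : 1 <= l ^+ 3 by rewrite exprn_ege1 //; lra.
  by rewrite exprS; nra.
have h3 : - ln eta <= `|ln eta| * A.
  rewrite (le_trans (ler_norm _)) // normrN ler_peMr //.
have h4 : A + 169 * (A / a) + `|ln eta| * A <= 14 / 100 * l * A.
  have -> : A + 169 * (A / a) + `|ln eta| * A = (1 + 169 / a + `|ln eta|) * A by ring.
  by rewrite ler_wpM2r //; lra.
have h6 : 14 / 100 * l * A = A * l / 5 - 6 * l * (A / 100) by field.
lra.
Qed.

(** Both terms are at most [expR (2 * l - ln q - 2 * g * A)], where [- ln q] pays for rounding [k]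
    down. Since [A >= a * l ^+ 4], one [g * A] absorbs [2 * l - ln q] and the doubling. *)
Lemma tail_condition (n r k : nat) (l A a q g : R) :
  100 <= l -> n%:R = expR l -> 0 < a -> a * l ^+ 4 <= A -> 0 < q -> q < 1 ->
  A / 100 - 1 <= k%:R -> r%:R <= n%:R :> R -> 
  0 < g -> 2 * g <= - ln q / 100 -> 2 * g <= 2 ->
  3 - ln q <= g * a * l ->
  n.+1%:R * expR A ^- 2 + r%:R * q ^+ k <= expR (- (g * A)).
Proof.
move=> l100 ne a0 aA q0 q1 kA rn g0 gq g2 hg.
have l0 : 0 < l by lra.
have lq : ln q < 0 by rewrite ln_lt0 // q0.
have A0 : 0 <= A by rewrite (le_trans _ aA) // mulr_ge0 ?exprn_ge0 // ltW.
have n1 : n.+1%:R <= expR (2 * l).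
  have : 1 + l <= n%:R by rewrite ne expR_ge1Dx.
  by rewrite expRM_natl -ne -natr1 expr2; nra.
have rn' : r%:R <= expR (2 * l).
  by apply: le_trans n1; rewrite -natr1; lra.
have t1 : n.+1%:R * expR A ^- 2 <= expR (2 * l - ln q - 2 * g * A).
  apply: (@le_trans _ _ (expR (2 * l) * expR (- (2 * A)))).
    by rewrite expRN [expR (2 * A)]expRM_natl ler_wpM2r // invr_ge0 exprn_ge0 // expR_ge0.
  by rewrite -expRD ler_expR; nra.
have t2 : r%:R * q ^+ k <= expR (2 * l - ln q - 2 * g * A).
  apply: (@le_trans _ _ (expR (2 * l) * expR (k%:R * ln q))).
    by rewrite [expR (k%:R * _)]expRM_natl lnK ?posrE // ler_wpM2r ?exprn_ge0 ?(ltW q0).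
  rewrite -expRD ler_expR -addrA lerD2l.
  have : k%:R * ln q <= (A / 100 - 1) * ln q by rewrite ler_wnM2r // ltW.
  have : 2 * g * A <= - ln q / 100 * A by rewrite ler_wpM2r.
  lra.
apply: (le_trans (lerD t1 t2)).
apply: (@le_trans _ _ (expR 1 * expR (2 * l - ln q - 2 * g * A))).
  have : 2 <= expR 1 :> R by rewrite (le_trans _ (expR_ge1Dx _)).
  have := expR_ge0 (2 * l - ln q - 2 * g * A); nra.
rewrite -expRD ler_expR.
have l3 : 1 <= l ^+ 3 by rewrite exprn_ege1 //; lra.
have : 1 + 2 * l - ln q <= g * A.
  apply: (@le_trans _ _ (g * (a * l ^+ 4))); last by rewrite ler_wpM2l // ltW.
  have -> : g * (a * l ^+ 4) = (g * a * l) * l ^+ 3 by ring.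
  apply: (@le_trans _ _ ((3 - ln q) * l ^+ 3)); last by rewrite ler_wpM2r // exprn_ge0 // ltW.
  have ll : l <= l ^+ 3 by rewrite !exprS expr0 mulr1; nra.
  nra.
lra.
Qed.

Lemma near_ln_ge (L : R) : \forall n \near \oo, L <= ln n%:R.
Proof.
near=> n.
have e0 := expR_gt0 L.
have /andP[_ h] := truncn_itv (ltW e0).
have hn : expR L <= n%:R.
  by rewrite (le_trans (ltW h)) // ler_nat; near: n; exact: nbhs_infty_ge.
by rewrite -(expRK L) ler_ln ?posrE // (lt_le_trans e0).
Unshelve. all: by end_near. Qed.

(** [l] exceeds the sum of all thresholds; the summands being nonnegative, each bound follows by
    dropping the others. *)
Lemma conditions_of_large (a b e K C l v : R) :
  0 < a -> 0 < b -> 0 <= K -> 0 <= C -> 0 <= v -> 0 <= e ->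
  100 + 9 * K + C + a^-1 + v * (100 / 14) + e / b + 1 <= l ->
  100 <= l /\ [/\ 9 * K < l, C <= 100 * l, 1 <= a * l, v <= 14 / 100 * l & e <= b * l].
Proof.
move=> a0 b0 K0 C0 v0 e0.
have ia : 0 < a^-1 by rewrite invr_gt0.
have ie : 0 <= e / b by rewrite divr_ge0 // ltW.
have -> : (1 <= a * l) = (a^-1 <= l) by rewrite -ler_pdivrMl // mulr1.
have -> : (e <= b * l) = (e / b <= l) by rewrite ler_pdivrMr // mulrC.
move: (a^-1) (e / b) ia ie => x y x0 y0 h.
by split; [lra|split; lra].
Qed.

(** Twice [m] is at most [4 * (s / l)], and the additive 3 is at most [s / l]; this 5 is the divisor
    in [A * l / 5]. *)
Lemma window_count (m : nat) (l s : R) : 100 <= l -> 9 * l ^+ 2 <= s ->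
  m%:R <= 2 * (s / l) -> (2 * m.+1).+1%:R <= 5 * (s / l) /\ 5 * (s / l) <= s.
Proof.
move=> l100 ls ms.
have l0 : 0 < l by lra.
have l2 : l <= l ^+ 2 by rewrite expr2 ler_peMl //; lra.
have h3 : 3 <= s / l by rewrite ler_pdivlMr // (le_trans _ ls) //; lra.
split; first by rewrite -natr1 natrM -natr1; lra.
have s0 : 0 <= s by lra.
by rewrite mulrA ler_pdivrMr // mulrC ler_wpM2l //; lra.
Qed.

Lemma expR_affine_ge1 (x : R) : 0 <= x -> 1 <= expR (164 * x + 1).
Proof. by move=> x0; rewrite (le_trans _ (expR_ge1Dx _)) //; lra. Qed.

Lemma interval_bounds (CE CW s : R) : 0 < CE -> 1 < CW -> 0 <= s ->
  [/\ - ((CE + CW) * s) <= - (CE * s), - (CE * s) <= CE * s, CE * s <= (CE + CW) * s,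
      - ((CE + CW) * s) <= CW^-1 * s <= CW * s &
      CW * s <= (CE + CW) * s].
Proof.
move=> CE0 CW1 s0.
have i0 : 0 < CW^-1 by rewrite invr_gt0; lra.
have i1 : CW^-1 <= 1 by rewrite invf_le1; lra.
move: CW^-1 i0 i1 => i i0 i1.
split.
- by rewrite lerN2 ler_wpM2r //; lra.
- by nra.
- by rewrite ler_wpM2r //; lra.
- by apply/andP; split; [nra|rewrite ler_wpM2r //; lra].
- by rewrite ler_wpM2r //; lra.
Qed.

End Asymptotics.

(** * Elliptic and Weyl weights *)

Section Weights.
Context (R : realType).
Implicit Types (c e g : nat -> R).

(** Squares avoid square roots. As [g] is nonincreasing, the ratio of consecutive [e] is multiplied
    each time by at most [j.+1 / j.+2 <= expR (- n^-1)], and the square root halves that exponent.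
    The elliptic model has [g j = (n - j) / n], the Weyl model [g = 1]. *)
Lemma regular_weights_sqr (n : nat) c e g : (0 < n)%N ->
  (forall j, 0 <= c j) -> (forall j, c j ^+ 2 = e j) ->
  e 0%N = 1 -> (forall j, (j <= n)%N -> 0 < e j) ->
  (forall j, (j < n)%N -> e j.+1 * j.+1%:R = e j * g j) ->
  (forall j, (j < n)%N -> n%:R^-1 <= g j <= 1) ->
  (forall j, (j.+1 < n)%N -> g j.+1 <= g j) ->
  regular_weights n c.
Proof.
move=> n0 c0 ce e0 ep er gb gd.
have N0 : 0 < n%:R :> R by rewrite ltr0n.
split.
- by apply/eqP; rewrite -(@eqrXn2 _ 2) ?ce ?e0 ?expr1n.
- move=> j jn; rewrite lt0r c0 andbT; apply: contraTneq (ep _ jn) => cj0.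
  by rewrite -ce cj0 expr0n ltxx.
- move=> j jn; rewrite -(@ler_pXn2r _ 2) ?nnegrE // !ce.
  have /andP[_ g1] := gb j jn.
  apply: (@le_trans _ _ (e j.+1 * j.+1%:R)).
    by rewrite ler_peMr ?ler1n // ltW // ep.
  by rewrite er // ler_piMr // ltW // ep // ltnW.
- move=> j jn; rewrite -(@ler_pXn2r _ 2) ?nnegrE ?mulr_ge0 // exprMn !ce.
  have /andP[g1 _] := gb j jn.
  have e1 := ep _ jn; have e2 := ep _ (ltnW jn).
  have : e j * n%:R^-1 <= e j.+1 * n%:R.
    apply: (@le_trans _ _ (e j * g j)); first by rewrite ler_wpM2l // ltW.
    by rewrite -er // ler_wpM2l ?(ltW e1) // ler_nat.
  rewrite ler_pdivrMr // => h.
  by have -> : n%:R ^+ 2 * e j.+1 = e j.+1 * n%:R * n%:R by ring.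
- move=> j jn; rewrite -(@ler_pXn2r _ 2) ?nnegrE ?mulr_ge0 ?exprn_ge0 ?expR_ge0 //.
  rewrite !exprMn !ce.
  have e1 := ep _ jn; have e2 := ep _ (ltnW jn); have e3 := ep _ (ltnW (ltnW jn)).
  have -> : expR (- (2 * n%:R)^-1) ^+ 2 = expR (- n%:R^-1) :> R.
    by rewrite -expRM_natl; congr expR; field; rewrite gt_eqF.
  have j2 : 0 < j.+2%:R :> R by rewrite ltr0n.
  have h1 : e j.+2 * e j * j.+2%:R <= j.+1%:R * e j.+1 ^+ 2.
    rewrite mulrAC er // expr2 mulrCA [_ * e j.+1]mulrC er ?(ltnW jn) // -mulrA.
    rewrite ler_wpM2l ?(ltW e2) // mulrC ler_wpM2l ?(ltW e3) //.
    exact: gd.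
  have h2 : j.+1%:R <= j.+2%:R * expR (- n%:R^-1) :> R.
    apply: (@le_trans _ _ (j.+2%:R * (1 - j.+2%:R^-1))).
      by rewrite mulrBr mulr1 divff ?gt_eqF // -[j.+2]addn1 natrD addrK.
    rewrite ler_wpM2l // (le_trans (expR_ge1Dx _)) // ler_expR lerN2.
    by rewrite lef_pV2 ?posrE // ler_nat.
  rewrite -(ler_pM2r j2) (le_trans h1) //.
  rewrite mulrAC [_ * j.+2%:R]mulrC.
  by rewrite ler_wpM2r // exprn_ge0 // ltW.
Qed.

Definition elliptic_weight (n j : nat) : R := Num.sqrt 'C(n, j)%:R / Num.sqrt n%:R ^+ j.

Definition weyl_weight (j : nat) : R := (Num.sqrt j`!%:R)^-1.

Lemma elliptic_polyE n a : elliptic_poly n a = weighted_poly (elliptic_weight n) n a.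
Proof. by apply/polyP => j; rewrite !coef_poly mulrA. Qed.

Lemma regular_elliptic n : (0 < n)%N -> regular_weights n (elliptic_weight n).
Proof.
move=> n0; have N0 : 0 < n%:R :> R by rewrite ltr0n.
apply: (@regular_weights_sqr n _ (fun j => 'C(n, j)%:R / n%:R ^+ j)
  (fun j => (n - j)%:R / n%:R)) => //.
- by move=> j; rewrite divr_ge0 ?exprn_ge0 ?sqrtr_ge0.
- by move=> j; rewrite expr_div_n sqr_sqrtr // -exprM mulnC exprM sqr_sqrtr.
- by rewrite bin0 expr0 divr1.
- by move=> j jn; rewrite divr_gt0 ?exprn_gt0 // ltr0n bin_gt0.
- move=> j jn; rewrite mulrAC -natrM mulnC mul_bin_left natrM exprSr invfM.
  by rewrite [(n - j)%:R * _]mulrC mulrACA.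
- move=> j jn; rewrite ler_pdivrMr // mul1r ler_nat leq_subr andbT.
  by rewrite -[leLHS]mul1r ler_wpM2r ?invr_ge0 // ler1n subn_gt0.
- by move=> j jn; rewrite ler_wpM2r ?invr_ge0 // ler_nat leq_sub2l.
Qed.

Lemma regular_weyl n : (0 < n)%N -> regular_weights n weyl_weight.
Proof.
move=> n0; have N0 : 0 < n%:R :> R by rewrite ltr0n.
apply: (@regular_weights_sqr n _ (fun j => j`!%:R^-1) (fun=> 1)) => //.
- by move=> j; rewrite invr_ge0 sqrtr_ge0.
- by move=> j; rewrite exprVn sqr_sqrtr.
- by rewrite fact0 invr1.
- by move=> j _; rewrite factS natrM invfM mulr1 mulrAC mulVf ?mul1r ?pnatr_eq0.
- by move=> j _; rewrite lexx andbT invf_le1 // ler1n.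
Qed.
End Weights.

(** * Root counts and their measurability *)

Section Roots.
Context (R : realType).
Implicit Types (p : {poly R}) (I : set R).

(** Multiplicity is encoded by repetition in the list; the zero polynomial needs no separate case,
    since everything divides it. *)
Definition has_roots I (m : R) p : Prop := exists rs : seq R,
  [/\ forall r, r \in rs -> I r, m <= (size rs)%:R &
      \prod_(r <- rs) ('X - r%:P) %| p].

Lemma prod_XsubC_mup_dvd p (X : seq R) : p != 0 -> uniq X ->
  exists rs : seq R, [/\ size rs = (\sum_(x <- X) mup x p)%N,
    {subset rs <= X} & \prod_(r <- rs) ('X - r%:P) %| p].
Proof.
move=> p0; elim: X => [|x X IH] /=.
  by exists [::]; rewrite !big_nil dvd1p.
case/andP=> xX /IH[rs [srs rsX dv]].
exists (nseq (mup x p) x ++ rs); split.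
- by rewrite size_cat size_nseq big_cons srs.
- move=> r; rewrite mem_cat inE => /orP[/nseqP[-> _]|/rsX ->]; rewrite ?eqxx ?orbT //.
- rewrite big_cat big_nseq iter_mulr_1 Gauss_dvdp; last first.
    rewrite coprimep_expl // coprimep_sym coprimep_XsubC root_prod_XsubC.
    by apply: contra xX; exact: rsX.
  by rewrite dv andbT -mup_geq.
Qed.

Lemma sum_mup_ge p (rs : seq R) : p != 0 -> \prod_(r <- rs) ('X - r%:P) %| p ->
  (size rs <= \sum_(x <- undup rs) mup x p)%N.
Proof.
move=> p0 /dvdpP[q pE].
have q0 : q != 0 by apply: contraNneq p0 => q0; rewrite pE q0 mul0r.
have -> : size rs = (\sum_(x <- undup rs) count_mem x rs)%N.
  rewrite -sum1_size -big_undup_iterop_count; apply: eq_bigr => x _.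
  by elim: (count_mem x rs) => [//|[//|k] IH]; rewrite -[in RHS]IH.
apply: leq_sum => x _.
have Pn0 : \prod_(r <- rs) ('X - r%:P) != 0 by rewrite monic_neq0 ?monic_prod_XsubC.
rewrite pE mupM // mu_prod_XsubC.
exact: leq_addl.
Qed.

Lemma real_le_nat_pred (m : R) : 0 < m -> exists N : nat, N%:R < m <= N.+1%:R.
Proof.
move=> m0.
have ex : exists k : nat, m <= k%:R.
  by exists (Num.truncn m).+1; have /andP[_ /ltW] := truncn_itv (ltW m0).
case: (ex_minnP ex) => -[|N] mN H; first by move: m0; rewrite ltNge mN.
exists N; rewrite mN andbT ltNge; apply/negP => /H.
by rewrite ltnn.
Qed.

Lemma nroots_geP I (m : R) p : 0 < m -> I !=set0 ->
  (m%:E <= nroots I p)%E <-> has_roots I m p.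
Proof.
move=> m0 [x0 Ix0]; rewrite /nroots; case: eqP => [->|/eqP p0].
  (* For the zero polynomial, copies of [x0] form the list; here [I] has to be nonempty. *)
  split=> _; last exact: leey.
  have [N /andP[_ mN]] := real_le_nat_pred m0.
  exists (nseq N.+1 x0); split; rewrite ?size_nseq ?dvdp0 // => r /nseqP[-> _] //.
split.
  (* The sum is a supremum over finite sets, so only a strict bound passes to one of them: an
     integer value above [N] is at least [N.+1 >= m]. *)
  have [N /andP[Nm mN]] := real_le_nat_pred m0.
  have Nm' : ((N%:R : R)%:E < m%:E)%E by rewrite lte_fin.
  move=> /(lt_le_trans Nm') /ereal_sup_gt[_ [X [finX XI] <-]].
  rewrite fsbig_finite //= sumEFin lte_fin -natr_sum ltr_nat => NS.
  have [rs [srs rsX dv]] := prod_XsubC_mup_dvd p0 (fset_uniq (fset_set X)).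
  exists rs; split=> //.
    by move=> r /rsX; rewrite in_fset_set // inE; exact: XI.
  by rewrite (le_trans mN) // ler_nat srs.
move=> [rs [rsI mrs dv]]; apply: esum_ge.
exists [set` undup rs].
  split; first exact: finite_seq.
  by move=> r /=; rewrite mem_undup => /rsI.
rewrite -fsbig_seq ?undup_uniq // sumEFin lee_fin -natr_sum (le_trans mrs) //.
by rewrite ler_nat sum_mup_ge.
Qed.

End Roots.

Lemma ultra_fmap (T U : Type) (f : T -> U) (F : set_system T) :
  UltraFilter F -> UltraFilter (f @ F).
Proof.
move=> FU; split; first exact: fmap_proper_filter.
move=> G PG FG; apply/seteqP; split=> // A GA.
have [//|FA] := in_ultra_setVsetC (f @^-1` A) FU.
have GC : G (~` A) by apply: FG.
by have := filter_ex (filterI GA GC) => -[x []].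
Qed.

(* A probability is unspecified on non-measurable sets, so the root-count events have
   to be measurable.  Having [N] roots in [[a, b]] is a closed condition on the
   coefficients: along an ultrafilter the roots converge by compactness, and the
   quotients by the linear factors then converge coefficientwise. *)
Section ClosedRoots.
Context (R : realType) (a b : R).
Implicit Types (p : {poly R}).

Definition exact_roots (N : nat) p : Prop := exists rs : seq R,
  [/\ size rs = N, forall r, r \in rs -> `[a, b]%classic r &
      \prod_(r <- rs) ('X - r%:P) %| p].

Lemma exact_rootsS N p : exact_roots N.+1 p ->
  exists r q, [/\ `[a, b]%classic r, exact_roots N q & p = ('X - r%:P) * q].
Proof.
move=> [rs [srs rsI dv]]; case: rs srs rsI dv => [//|r rs] /= [srs] rsI /dvdpP[q pE].
exists r, (q * \prod_(r <- rs) ('X - r%:P)); split.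
- by apply: rsI; rewrite mem_head.
- exists rs; split=> //; last exact: dvdp_mull.
  by move=> x xrs; apply: rsI; rewrite inE xrs orbT.
- by rewrite pE big_cons; ring.
Qed.

Lemma coef_XsubC_mul (r : R) (q : {poly R}) i :
  (('X - r%:P) * q)`_i.+1 = q`_i - r * q`_i.+1.
Proof. by rewrite mulrBl coefB coefXM coefCM. Qed.

Lemma exact_roots_ultralimit (U : set_system nat) (n N : nat)
    (pm : nat -> {poly R}) p : UltraFilter U ->
  (forall m, (size (pm m) <= n)%N) -> (size p <= n)%N ->
  (forall i, (fun m => (pm m)`_i) @ U --> p`_i) ->
  (forall m, exact_roots N (pm m)) -> exact_roots N p.
Proof.
move=> UU; elim: N pm p => [|N IH] pm p spm sp cp rpm.
  by exists [::]; split=> //; rewrite big_nil dvd1p.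
have [f fP] := choice (fun m => exact_rootsS (rpm m)).
have [qm qmP] := choice fP.
have cab := @segment_compact R a b.
rewrite compact_ultra in cab.
have [r0 [/= r0I cr]] : `[a, b]%classic `&` [set r0 | f @ U --> r0] !=set0.
  apply: cab; first exact: ultra_fmap.
  by apply: (@filterE _ U) => m; case: (qmP m).
have sqm m : (size (qm m) <= n)%N.
  have [_ _ E] := qmP m.
  have [->|q0] := eqVneq (qm m) 0; first by rewrite size_poly0.
  rewrite (leq_trans _ (spm m)) // E mulrC size_Mmonic ?monicXsubC // size_XsubC.
  by rewrite addn2 /= leqnSn.
(* The coefficients of the quotient converge from the top down: they vanish from index [n] on, and
   [q_i = p_(i+1) + r * q_(i+1)] passes convergence to the next lower index; [k] counts the
   steps. *)
have limq k i : (n <= i + k)%N -> exists l : R, (fun m => (qm m)`_i) @ U --> l.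
  elim: k i => [|k IHk] i ik.
    exists 0; apply: (@cvg_trans _ ((fun=> (0 : R)) @ U)); last exact: cvg_cst.
    apply: near_eq_cvg; apply: filterE => m.
    by rewrite nth_default // (leq_trans (sqm m)) // -(addn0 i).
  have [l cl] : exists l : R, (fun m => (qm m)`_i.+1) @ U --> l by apply: IHk; rewrite addSnnS.
  exists (p`_i.+1 + r0 * l).
  apply: (@cvg_trans _ ((fun m => (pm m)`_i.+1 + f m * (qm m)`_i.+1) @ U)).
    apply: near_eq_cvg; apply: filterE => m.
    have [_ _ E] := qmP m.
    by rewrite {1}E coef_XsubC_mul subrK.
  by apply: cvgD => //; apply: cvgM.
have [l lP] := choice (fun i => limq n i (leq_addl _ _)).
pose q := \poly_(i < n) l i.
have cq i : (fun m => (qm m)`_i) @ U --> q`_i.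
  rewrite coef_poly; case: ltnP => // ni.
  apply: (@cvg_trans _ ((fun=> (0 : R)) @ U)); last exact: cvg_cst.
  apply: near_eq_cvg; apply: filterE => m.
  by rewrite nth_default // (leq_trans (sqm m)).
have pE : p = ('X - r0%:P) * q.
  apply/polyP => i; apply: (cvg_unique _ (cp i)) => //.
  apply: (@cvg_trans _ ((fun m => (('X - (f m)%:P) * qm m)`_i) @ U)).
    apply: near_eq_cvg; apply: filterE => m.
    by have [_ _ <-] := qmP m.
  case: i => [|i].
    have -> : (('X - r0%:P) * q)`_0 = - (r0 * q`_0).
      by rewrite mulrBl coefB coefXM coefCM sub0r.
    apply: (@cvg_trans _ ((fun m => - (f m * (qm m)`_0)) @ U)).
      apply: near_eq_cvg; apply: filterE => m.
      by rewrite mulrBl coefB coefXM coefCM sub0r.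
    by apply: cvgN; apply: cvgM.
  rewrite coef_XsubC_mul.
  apply: (@cvg_trans _ ((fun m => (qm m)`_i - f m * (qm m)`_i.+1) @ U)).
    by apply: near_eq_cvg; apply: filterE => m; rewrite coef_XsubC_mul.
  by apply: cvgB => //; apply: cvgM.
have rq m : exact_roots N (qm m) by case: (qmP m).
have [rs [srs rsI dv]] := IH qm q sqm (size_poly _ _) cq rq.
exists (r0 :: rs); split.
- by rewrite /= srs.
- by move=> r; rewrite inE => /orP[/eqP->|/rsI].
- by rewrite big_cons pE dvdp_mul.
Qed.
End ClosedRoots.

(** * Probability estimates *)

Section Fibers.
Context (R : realType) (d : measure_display) (T : measurableType d) (P : probability T R).
Implicit Types (X : nat -> {RV P >-> R}).

Lemma measurable_RV_preimage (Y : {RV P >-> R}) (B : set R) :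
  measurable B -> measurable (Y @^-1` B).
Proof. by move=> mB; rewrite -[X in measurable X]setTI; exact: measurable_funP. Qed.

Lemma measurable_norm_ge (M : R) : measurable [set x : R | M <= `|x|].
Proof.
rewrite -[X in measurable X]setTI.
rewrite (_ : [set x | _] = (@Num.norm _ R) @^-1` `[M, +oo[%classic).
  by apply: normr_measurable => //; exact: measurable_itv.
by apply/seteqP; split => x; rewrite /= in_itv /= andbT.
Qed.

Lemma fin_prob (A : set T) : measurable A -> P A \is a fin_num.
Proof. exact: fin_num_measure. Qed.

Lemma prob_box X (n : nat) (B : nat -> set R) :
  mutually_independent X -> (forall j, measurable (B j)) ->
  P (\bigcap_(j in `I_n) (X j @^-1` B j)) = (\prod_(j < n) fine (P (X j @^-1` B j)))%:E.
Proof.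
move=> ind mB.
pose J : {fset nat} := [fset j in iota 0 n]%fset.
have := ind J B (fun j _ => mB j).
have -> : [set` J] = `I_n.
  by apply/seteqP; split => j /=; rewrite !inE mem_iota /= add0n.
move=> ->.
rewrite (perm_big (iota 0 n)); last first.
  apply: uniq_perm; rewrite ?fset_uniq ?iota_uniq // => j.
  by rewrite !inE.
rewrite (big_morph EFin (@EFinM _) (erefl _)).
rewrite -{1}[n]subn0 -/(index_iota 0 n) big_mkord; apply: eq_bigr => j _.
by rewrite fineK // fin_prob //; exact: measurable_RV_preimage.
Qed.

Lemma prob_bigsetU_le (I : Type) (s : seq I) (Q : pred I) (F : I -> set T) :
  (forall i, measurable (F i)) ->
  (P (\big[setU/set0]_(i <- s | Q i) F i) <= \sum_(i <- s | Q i) P (F i))%E.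
Proof.
move=> mF.
suff : measurable (\big[setU/set0]_(i <- s | Q i) F i) /\
  (P (\big[setU/set0]_(i <- s | Q i) F i) <= \sum_(i <- s | Q i) P (F i))%E by case.
elim/big_rec2: _ => [|i y A _ [mA Ay]]; first by rewrite measure0.
split; first exact: measurableU.
by rewrite (le_trans (measureU2 _ _ _)) // leeD2l.
Qed.

Lemma cell_index (M h x : R) : 0 < h -> `|x| <= M ->
  (Num.truncn ((x + M) / h) < (Num.truncn (2 * M / h)).+1)%N /\
  (- M + (Num.truncn ((x + M) / h))%:R * h <= x < - M + (Num.truncn ((x + M) / h)).+1%:R * h).
Proof.
move=> h0 xM; have /andP[x1 x2] : - M <= x <= M by rewrite -ler_norml.
have y0 : 0 <= (x + M) / h by rewrite divr_ge0 ?(ltW h0) //; lra.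
split.
  rewrite ltnS truncn_ge_nat; last by rewrite divr_ge0 ?(ltW h0) //; lra.
  rewrite (le_trans _ (_ : (x + M) / h <= _)) //; first by rewrite truncn_le.
  by rewrite ler_wpM2r ?invr_ge0 ?(ltW h0) //; lra.
have /andP[] := truncn_itv y0.
rewrite ler_pdivlMr // ltr_pdivrMr // => h1 h2.
by apply/andP; split; lra.
Qed.

(* Outside the window the coefficients are discretised into cells; inside it they
   lie in intervals of radius [eta] depending only on the cells, so
   independence bounds each piece by [q ^+ k] times the probability of its cells. *)
Lemma fiber_prob X (n k j1 : nat) (eta h q M : R) (E : set T) :
  mutually_independent X -> (j1 + k <= n.+1)%N -> 0 < h ->
  (forall j (u : R), (P (X j @^-1` `[(u - eta)%R, (u + eta)%R]%classic) <= q%:E)%E) ->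
  (forall w, E w -> forall j, (j <= n)%N -> `|X j w| <= M) ->
  (forall w w', E w -> E w' ->
    (forall j, (j <= n)%N -> ~~ (j1 <= j < j1 + k)%N -> `|X j w - X j w'| <= h) ->
    forall j, (j1 <= j < j1 + k)%N -> `|X j w - X j w'| <= eta) ->
  exists2 B, measurable B & E `<=` B /\ (P B <= (q ^+ k)%:E)%E.
Proof.
move=> ind jk h0 Xq EM Erig.
pose W j := (j1 <= j < j1 + k)%N.
pose m := Num.truncn (2 * M / h).
pose D (i : nat) : set R := `[- M + i%:R * h, - M + i.+1%:R * h[%classic.
pose cell (f : {ffun 'I_n.+1 -> 'I_m.+1}) w :=
  E w /\ forall j : 'I_n.+1, ~~ W j -> D (f j) (X j w).
(* Any point of the cell serves as centre; for an empty cell every value works, here 0. *)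
have [u uP] : exists u : {ffun 'I_n.+1 -> 'I_m.+1} -> nat -> R,
    forall f w, cell f w -> forall j, W j -> `|X j w - u f j| <= eta.
  have H f : exists v : nat -> R, forall w, cell f w -> forall j, W j -> `|X j w - v j| <= eta.
    have [[w0 c0]|no] := pselect (exists w, cell f w); last first.
      by exists (fun=> 0) => w cw; exfalso; apply: no; exists w.
    exists (fun j => X j w0) => w cw j Wj.
    apply: (Erig _ _ cw.1 c0.1) => // i iN Wi.
    have iN' : (i < n.+1)%N by [].
    have := cw.2 (Ordinal iN') Wi; have := c0.2 (Ordinal iN') Wi.
    rewrite /D /= !in_itv /= -natr1 mulrDl mul1r => /andP[a1 a2] /andP[b1 b2].
    by rewrite ler_norml; apply/andP; split; lra.
  by exists (fun f => sval (cid (H f))) => f; case: cid.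
pose side f (j : nat) : set R := if W j then `[u f j - eta, u f j + eta]%classic
  else if insub j is Some i then D (f i) else setT.
have mside f j : measurable (side f j).
  by rewrite /side; case: ifP => _; [|case: insub => [i|]];
    [exact: measurable_itv|exact: measurable_itv|exact: measurableT].
pose box f := \bigcap_(j in `I_n.+1) (X j @^-1` side f j).
have mbox f : measurable (box f).
  by apply: bigcap_measurable => [|j _]; [exists 0%N|exact: measurable_RV_preimage].
(* Cell choices are fixed to [ord0] on the window, so that each pattern outside the window is listed
   once. *)
pose F := pffun_on (ord0 : 'I_m.+1) (fun i : 'I_n.+1 => ~~ W i) xpredT.
exists (\big[setU/set0]_(f in F) box f); first exact: bigsetU_measurable.
split.
  move=> w Ew.
  pose f : {ffun 'I_n.+1 -> 'I_m.+1} :=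
    [ffun i : 'I_n.+1 => if W i then ord0 else inord (Num.truncn ((X i w + M) / h))].
  have fF : f \in F.
    apply/pffun_onP; split; last by move=> y /mapP[x _ ->].
    by apply/supportP => x; rewrite negbK => Wx; rewrite ffunE Wx.
  have cf : cell f w.
    split=> // j Wj; rewrite /D /= in_itv /= ffunE (negbTE Wj).
    have [c1 c2] := cell_index h0 (EM w Ew j (leq_ord j)).
    by rewrite inordK.
  rewrite (bigD1 f) //=; left => j jn /=; rewrite /side.
  case: ifP => Wj.
    have := uP f w cf j Wj; rewrite ler_norml => /andP[b1 b2].
    by rewrite /= in_itv /=; apply/andP; split; lra.
  case: insubP => // i _ ij; rewrite -ij; apply: cf.2.
  by rewrite ij Wj.
apply: (le_trans (prob_bigsetU_le _ _ mbox)).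
pose p (i : 'I_n.+1) (c : 'I_m.+1) : R := fine (P (X i @^-1` D c)).
have mD i (c : 'I_m.+1) : measurable (X i @^-1` D c).
  by apply: measurable_RV_preimage; exact: measurable_itv.
have p0 i c : 0 <= p i c by exact: fine_ge0.
have q0 : 0 <= q.
  by rewrite -lee_fin (le_trans _ (Xq 0%N 0)).
have boxE f : (P (box f) <= (q ^+ k * \prod_(i < n.+1 | ~~ W i) p i (f i))%:E)%E.
  rewrite (prob_box _ ind (mside f)) lee_fin (bigID (fun i : 'I_n.+1 => W i)) /=.
  apply: ler_pM; rewrite ?prodr_ge0 //.
  - by move=> i _; exact: fine_ge0.
  - by move=> i _; exact: fine_ge0.
  - have -> : q ^+ k = \prod_(i < n.+1 | W i) q.
      by rewrite (window_big _ (fun=> q)) // prodr_const card_ord.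
    apply: ler_prod => i Wi; rewrite fine_ge0 //= -lee_fin fineK; last first.
      by apply: fin_prob; exact: measurable_RV_preimage.
    by rewrite /side Wi Xq.
  - rewrite le_eqVlt; apply/orP; left; apply/eqP; apply: eq_bigr => i Wi.
    by rewrite /side (negbTE Wi) valK.
apply: (le_trans (lee_sum _ (fun f _ => boxE f))).
(* Distributivity turns the sum over patterns into a product over indices of sums over cells; the
   cells are disjoint, so each sum is at most 1. *)
rewrite sumEFin lee_fin -mulr_sumr -(big_distr_big ord0) /=.
rewrite ler_piMr ?exprn_ge0 // prodr_ile1 // => i Wi.
rewrite sumr_ge0 //=.
have -> : \sum_(c < m.+1) p i c = fine (\sum_(c < m.+1) P (X i @^-1` D c))%E.
  by rewrite sum_fine // => c _; apply: fin_prob.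
have mD' (c : nat) : measurable (X i @^-1` D c).
  by apply: measurable_RV_preimage; exact: measurable_itv.
rewrite -(@measure_bigsetU _ _ _ P (fun c => X i @^-1` D c)) //.
  rewrite -lee_fin fineK ?probability_le1 //; first exact: bigsetU_measurable.
  by apply: fin_prob; exact: bigsetU_measurable.
apply/trivIsetP => c c' _ _ cc'; apply/seteqP; split => // w [].
rewrite /D /= !in_itv /= => /andP[a1 a2] /andP[b1 b2].
exfalso; move: cc'; rewrite neq_ltn => /orP[lt|lt].
  have : c.+1%:R * h <= c'%:R * h by rewrite ler_wpM2r ?(ltW h0) // ler_nat.
  by lra.
have : c'.+1%:R * h <= c%:R * h by rewrite ler_wpM2r ?(ltW h0) // ler_nat.
by lra.
Qed.
End Fibers.

(** * Measurability of the root-count events in the random coefficients *)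

Section MeasurableRoots.
Context (R : realType) (d : measure_display) (T : measurableType d) (P : probability T R).
Implicit Types (X : nat -> {RV P >-> R}) (c : nat -> R).

(** Otherwise coefficient vectors with [N] roots would tend to [u], and the limit along an
    ultrafilter would have [N] roots too. *)
Lemma exact_roots_open (al be : R) c (n N : nat) (u : nat -> R) :
  ~ exact_roots al be N (weighted_poly c n u) ->
  exists2 e : R, 0 < e & forall v, (forall j, (j <= n)%N -> `|v j - u j| < e) ->
    ~ exact_roots al be N (weighted_poly c n v).
Proof.
move=> nu; apply: contrapT => no.
have H (m : nat) : exists v : nat -> R, (forall j, (j <= n)%N -> `|v j - u j| < m.+1%:R^-1) /\
    exact_roots al be N (weighted_poly c n v).
  apply: contrapT => nov; apply: no; exists m.+1%:R^-1 => // v vu rv.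
  by apply: nov; exists v.
have [v vP] := choice H.
have [U [UU sU]] := ultraFilterLemma (eventually_filter).
apply: nu; apply: (@exact_roots_ultralimit R al be U n.+1 N (fun m => weighted_poly c n (v m))).
- by move=> m; exact: size_poly.
- exact: size_poly.
- move=> i; rewrite coef_poly; case: ltnP => ni; last first.
    apply: (@cvg_trans _ ((fun=> (0 : R)) @ U)); last exact: cvg_cst.
    apply: near_eq_cvg; apply: filterE => m.
    by rewrite coef_poly ltnNge ni.
  apply: (@cvg_trans _ ((fun m => v m i * c i) @ U)).
    by apply: near_eq_cvg; apply: filterE => m; rewrite coef_poly ni.
  apply: cvgM; last exact: cvg_cst.
  have cv : (fun m => v m i) @ \oo --> u i.
    apply/cvgrPdist_lt => e e0; near=> m.
    rewrite distrC (lt_trans ((vP m).1 i _)) //.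
    near: m; exact: near_infty_natSinv_lt (PosNum e0).
  by move=> A /cv; exact: sU.
- by move=> m; case: (vP m).
Unshelve. all: by end_near. Qed.

Lemma measurable_exact_roots (al be : R) c (n N : nat) X :
  measurable [set w | exact_roots al be N (weighted_poly c n (fun j => X j w))].
Proof.
rewrite -[X in measurable X]setCK; apply: measurableC.
(* Cubes with rational centres and radii [1 / k.+1] are countable, and the complement is the union
   of those that avoid the closed set. *)
pose G : Type := ({ffun 'I_n.+1 -> rat} * nat)%type.
pose cube (g : G) (v : nat -> R) := forall j : 'I_n.+1, `|v j - ratr (g.1 j)| < g.2.+1%:R^-1.
pose F (g : G) : set T := if `[< forall v, cube g v -> ~ exact_roots al be N (weighted_poly c n v) >]
  then [set w | cube g (fun j => X j w)] else set0.
have -> : ~` [set w | exact_roots al be N (weighted_poly c n (fun j => X j w))] = \bigcup_g F g.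
  apply/seteqP; split => [w /= nw|w [g _]]; last first.
    by rewrite /F; case: asboolP => // H cw; exact: H.
  have [e e0 He] := exact_roots_open nw.
  (* Twice the radius has to stay below [e], since two points of a cube are compared through its
     centre. *)
  have [k ke] : exists k : nat, 2 * k.+1%:R^-1 < e.
    exists (Num.truncn (2 / e)).
    have v0 : 0 < 2 / e by rewrite divr_gt0.
    have /andP[_] := truncn_itv (ltW v0).
    rewrite ltr_pdivrMr // => h; rewrite ltr_pdivrMr // mulrC //.
  have k0 : 0 < k.+1%:R^-1 :> R by rewrite invr_gt0.
  have ex (j : 'I_n.+1) : exists r : rat, `|X j w - ratr r| < k.+1%:R^-1.
    have lt : X j w - k.+1%:R^-1 < X j w + k.+1%:R^-1.
      by rewrite ltrBlDr -addrA ltrDl addr_gt0.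
    have [r] := rat_in_itvoo lt.
    by rewrite in_itv /= => /andP[r1 r2]; exists r; rewrite ltr_distlC r1 r2.
  have [g gP] := choice ex.
  exists ([ffun j => g j], k) => //.
  have cg : cube ([ffun j => g j], k) (fun j => X j w) by move=> j /=; rewrite ffunE.
  rewrite /F asboolT // => v cv; apply: He => j jn.
  have := cg (Ordinal (jn : (j < n.+1)%N)); have := cv (Ordinal (jn : (j < n.+1)%N)).
  rewrite /=; set r := ratr _ => h1 h2.
  have -> : v j - X j w = (v j - r) - (X j w - r) by ring.
  apply: (le_lt_trans (ler_normB _ _)). apply: (lt_trans (ltrD h1 h2)).
  by move: ke; rewrite mulr_natl mulr2n.
apply: (@countable_bigcupT_measurable d T G F); first exact: countableP.
move=> g; rewrite /F; case: asboolP => // _.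
rewrite (_ : [set w | _] = \bigcap_(j in [set: 'I_n.+1])
    (X j @^-1` `](ratr (g.1 j) - g.2.+1%:R^-1), (ratr (g.1 j) + g.2.+1%:R^-1)[%classic)).
  apply: fin_bigcap_measurable => // j _.
  by apply: measurable_RV_preimage; exact: measurable_itv.
apply/seteqP; split => w /=.
  by move=> cw j _ /=; rewrite in_itv /= -ltr_distl.
by move=> H j; have := H j I; rewrite /= in_itv /= -ltr_distl.
Qed.

Lemma measurable_many_roots X c (n : nat) (al be m : R) : 0 < m -> al <= be ->
  measurable (many_roots X (weighted_poly c n) `[al, be]%classic m).
Proof.
move=> m0 ab.
have I0 : `[al, be]%classic !=set0 by exists al; rewrite /= in_itv /= lexx.
rewrite (_ : many_roots _ _ _ _ = \bigcup_(N in [set N : nat | m <= N%:R])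
    [set w | exact_roots al be N (weighted_poly c n (fun j => X j w))]).
  by apply: bigcup_measurable => N _; exact: measurable_exact_roots.
apply/seteqP; split => w /=.
  rewrite /many_roots /= => /(nroots_geP _ m0 I0) [rs [rsI mrs dv]].
  by exists (size rs) => //; exists rs.
move=> [N mN [rs [srs rsI dv]]]; apply/(nroots_geP _ m0 I0).
by exists rs; split; rewrite ?srs.
Qed.
End MeasurableRoots.

(** * Anti-concentration and tails from mean and variance *)

Section Moments.
Context (R : realType) (d : measure_display) (T : measurableType d) (P : probability T R).

(** For a variable of constant sign the expectation of [|Y|] is that of [Y] up to sign, hence 0. *)
Lemma ae_eq0_of_sign (Y : {RV P >-> R}) (s : R) : `|s| = 1 ->
  ('E_P[Y] = 0)%E -> (\forall w \ae P, 0 <= s * Y w) -> \forall w \ae P, Y w = 0.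
Proof.
move=> s1 EY sY.
have s_pm : s = 1 \/ s = -1.
  have : s ^+ 2 = 1 by rewrite -[s ^+ 2]real_normK ?num_real // s1 expr1n.
  by move/eqP; rewrite sqrf_eq1 => /orP[] /eqP; [left|right].
have mY : measurable_fun setT (EFin \o Y : T -> \bar R) by exact/measurable_EFinP.
have mabs : measurable_fun setT (EFin \o (fun w => `|Y w|) : T -> \bar R).
  by apply/measurable_EFinP; exact: measurableT_comp.
have : (\int[P]_w `|(EFin \o Y) w| = 0)%E.
  move: EY sY; rewrite expectation_def => EY sY.
  have [s_1|s_1] := s_pm.
    rewrite -EY; apply: ae_eq_integral => //.
    by move: sY; apply: filterS => w; rewrite s_1 mul1r => Yw _; rewrite /= ger0_norm.
  apply/eqP; rewrite -oppe_eq0 -integral_ge0N // -EY; apply/eqP.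
  apply: ae_eq_integral => //.
    by apply: measurableT_comp; [exact: oppe_measurable|exact: mabs].
  move: sY; apply: filterS => w; rewrite s_1 mulN1r oppr_ge0 => Yw _.
  by rewrite /= ler0_norm // -?EFinN ?opprK. 
move=> /(ae_eq_integral_abs _ measurableT mY).
by apply: filterS => w /(_ I) [].
Qed.

(** Without such an [h], [s * Y] would be almost surely nonpositive; mean zero would make [Y] vanish
    almost surely, against variance one. *)
Lemma exists_prob_pos (Y : {RV P >-> R}) (s : R) : `|s| = 1 ->
  ('E_P[Y] = 0)%E -> ('V_P[Y] = 1)%E ->
  exists2 h : R, 0 < h & (0 < P [set w | (h <= s * Y w)%R])%E.
Proof.
move=> s1 EY VY; apply: contrapT => no.
have P0 (n : nat) : P [set w | n.+1%:R^-1 <= s * Y w] = 0%E.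
  apply/eqP; rewrite eq_le measure_ge0 andbT leNgt; apply/negP => h.
  by apply: no; exists n.+1%:R^-1.
have mS (n : nat) : measurable [set w | n.+1%:R^-1 <= s * Y w].
  rewrite (_ : [set w | _] = (fun w => s * Y w) @^-1` `[n.+1%:R^-1, +oo[%classic).
    rewrite -[X in measurable X]setTI; apply: measurable_funM => //; exact: measurable_itv.
  by apply/seteqP; split => w; rewrite /= in_itv /= andbT.
have aeY : \forall w \ae P, Y w = 0.
  apply: (@ae_eq0_of_sign Y (- s)) => //; first by rewrite normrN.
  have : \forall w \ae P, forall n : nat, s * Y w < n.+1%:R^-1.
    apply: ae_foralln => n; exists [set w | n.+1%:R^-1 <= s * Y w]; split; [exact: mS|exact: P0|].
    by move=> w /= /negP; rewrite -leNgt.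
  apply: filterS => w H; rewrite mulNr oppr_ge0 leNgt; apply/negP => sY0.
  have := H (Num.truncn (s * Y w)^-1); apply/negP; rewrite -leNgt.
  rewrite -[leRHS]invrK lef_pV2 ?posrE ?invr_gt0 // ltW //.
  have v0 : 0 < (s * Y w)^-1 by rewrite invr_gt0.
  by have /andP[_] := truncn_itv (ltW v0).
have : ('V_P[Y] = 0)%E.
  rewrite /variance covariance.unlock EY /= expectation.unlock.
  rewrite (@ae_eq_integral _ _ _ P setT (cst 0%E)) ?integral0 //.
    by apply/measurable_EFinP; apply: measurable_funM; apply: measurable_funB.
  move: aeY; apply: filterS => w Yw0 _.
  have -> : ((Y \- cst 0) * (Y \- cst 0)) w = (Y w - 0) * (Y w - 0) by [].
  by rewrite Yw0 subr0 mulr0.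
by rewrite VY => /eqP; rewrite onee_eq0.
Qed.

Lemma prob_le_of_disjoint (A B : set T) (q : R) : measurable A -> measurable B ->
  A `&` B = set0 -> 1 - q <= fine (P B) -> (P A <= q%:E)%E.
Proof.
move=> mA mB AB qB.
have : (P A <= P (~` B))%E.
  apply: le_measure; rewrite ?inE //; first exact: measurableC.
  by move=> w Aw Bw; have : (A `&` B) w by []; rewrite AB.
move=> /le_trans; apply; rewrite probability_setC //.
rewrite -(fineK (fin_prob P mB)) -EFinB lee_fin; lra.
Qed.

(** [Y >= h1] and [Y <= - h2] both have positive probability for some positive [h1] and [h2], and an
    interval of length [h1] misses one of these half-lines. *)
Lemma anticoncentration (Y : {RV P >-> R}) : ('E_P[Y] = 0)%E -> ('V_P[Y] = 1)%E ->
  exists eta q : R, [/\ 0 < eta, 0 < q, q < 1 &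
    forall u : R, (P (Y @^-1` `[(u - eta)%R, (u + eta)%R]%classic) <= q%:E)%E].
Proof.
move=> EY VY.
have [h1 h10 P1] := @exists_prob_pos Y 1 (normr1 _) EY VY.
have [h2 h20 P2] := @exists_prob_pos Y (-1) (normrN1 _) EY VY.
have mS (s h : R) : measurable [set w | h <= s * Y w].
  rewrite (_ : [set w | _] = (fun w => s * Y w) @^-1` `[h, +oo[%classic).
    rewrite -[X in measurable X]setTI; apply: measurable_funM => //; exact: measurable_itv.
  by apply/seteqP; split => w; rewrite /= in_itv /= andbT.
set A1 := [set w | _] in P1; set A2 := [set w | _] in P2.
have f1 : 0 < fine (P A1).
  by rewrite -lte_fin fineK // fin_prob //; exact: mS.
have f2 : 0 < fine (P A2).
  by rewrite -lte_fin fineK // fin_prob //; exact: mS.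
have f1' : fine (P A1) <= 1.
  by rewrite -lee_fin fineK ?probability_le1 // ?fin_prob //; exact: mS.
clear P1 P2 EY VY.
pose g := Num.min (fine (P A1)) (fine (P A2)).
have g0 : 0 < g by rewrite lt_min f1.
have [g1 g2] : g <= fine (P A1) /\ g <= fine (P A2) by rewrite !ge_min !lexx orbT.
(* Halving [g] makes [q] positive from [g <= 1] alone. *)
exists (h1 / 2), (1 - g / 2); split; [lra|lra|lra|] => u.
have mI : measurable (Y @^-1` `[(u - h1 / 2)%R, (u + h1 / 2)%R]%classic).
  by apply: measurable_RV_preimage; exact: measurable_itv.
have [uh|uh] := ltP (u + h1 / 2) h1.
  apply: (prob_le_of_disjoint mI (mS 1 h1)); last by rewrite -/A1; lra.
  apply/seteqP; split => // w []; rewrite /= in_itv /= mul1r => /andP[a b] c; lra.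
apply: (prob_le_of_disjoint mI (mS (-1) h2)); last by rewrite -/A2; lra.
apply/seteqP; split => // w []; rewrite /= in_itv /= mulN1r => /andP[a b] c; lra.
Qed.

Lemma prob_large (Y : {RV P >-> R}) (M : R) : 0 < M ->
  ('E_P[Y] = 0)%E -> ('V_P[Y] = 1)%E ->
  (P (Y @^-1` [set x | (M <= `|x|)%R]) <= (M ^- 2)%:E)%E.
Proof.
move=> M0 EY VY; have := chebyshev Y M0.
rewrite EY VY mule1 /=; apply: le_trans; rewrite le_eqVlt; apply/orP; left; apply/eqP.
by congr (P _); apply/seteqP; split => w /=; rewrite subr0.
Qed.
End Moments.

(** * Union bound over windows and over large coefficients *)

Section Union.
Context (R : realType) (d : measure_display) (T : measurableType d) (P : probability T R).
Implicit Types (X : nat -> {RV P >-> R}) (c : nat -> R).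

Definition window_event X (n : nat) c (M delta : R) (I : pred R) : set T :=
  [set w | (forall j, (j <= n)%N -> `|X j w| <= M) /\ exists rs : seq R,
    [/\ all I rs, (4^-1) ^+ size rs <= delta &
        \prod_(r <- rs) ('X - r%:P) %| weighted_poly c n (fun j => X j w)]].

Lemma rigid_prob X (n k : nat) c (M delta eta q : R) (I : pred R) :
  mutually_independent X -> 0 < M -> 0 < delta ->
  (forall j (u : R), (P (X j @^-1` `[(u - eta)%R, (u + eta)%R]%classic) <= q%:E)%E) ->
  rigid_on n c M delta eta k I ->
  exists2 B, measurable B & window_event X n c M delta I `<=` B
    /\ (P B <= (q ^+ k)%:E)%E.
Proof.
move=> ind M0 d0 Xq [j1 j1k rig].
apply: (@fiber_prob _ _ _ P X n k j1 eta (M * delta) q M) => //.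
- by rewrite mulr_gt0.
- by move=> w [].
move=> w w' [wM [rs [rsI sd dv]]] [w'M [rs' [rsI' sd' dv']]] close.
exact: (rig _ _ rs rs').
Qed.

Lemma pigeonhole_windows (r : nat) (W : nat -> pred R) (rs : seq R) (y : R) :
  (0 < r)%N -> (forall x, x \in rs -> exists2 i, (i < r)%N & W i x) ->
  r%:R * y <= (size rs)%:R -> exists2 i, (i < r)%N & y <= (count (W i) rs)%:R.
Proof.
move=> r0 cov yr; apply: contrapT => no.
have hlt (i : 'I_r) : (count (W i) rs)%:R < y.
  by rewrite ltNge; apply/negP => h; apply: no; exists i.
have : (size rs <= \sum_(i < r) count (W i) rs)%N.
  elim: rs cov {yr no hlt} => [|x rs IH] cov; first by rewrite big1.
  have [i ir Wx] := cov x (mem_head _ _).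
  rewrite /= big_split /= -add1n leq_add //.
    by rewrite (bigD1 (Ordinal ir)) //= Wx.
  by apply: IH => z zs; apply: cov; rewrite inE zs orbT.
rewrite -(ler_nat R) natr_sum => h.
have : \sum_(i < r) (count (W i) rs)%:R < \sum_(i < r) y.
  rewrite (bigD1 (Ordinal r0)) //= [ltRHS](bigD1 (Ordinal r0)) //=.
  apply: ltr_leD; first exact: (hlt (Ordinal r0)).
  by apply: ler_sum => i _; exact: ltW (hlt i).
rewrite sumr_const card_ord -[y *+ r]mulr_natl => /(le_lt_trans h).
by move=> /(le_lt_trans yr); rewrite ltxx.
Qed.

(** If no coefficient reaches [M], the pigeonhole principle puts at least [y] roots into one window;
    [rigid_prob] bounds each of the [r] windows and [Xlarge] each of the [n.+1] coefficients. *)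
Lemma many_roots_prob X (n k r : nat) c (M delta eta q y m al be : R) (W : nat -> pred R) :
  mutually_independent X -> 0 < M -> 0 < delta ->
  (forall j (u : R), (P (X j @^-1` `[(u - eta)%R, (u + eta)%R]%classic) <= q%:E)%E) ->
  (forall j, (P (X j @^-1` [set x | (M <= `|x|)%R]) <= (M ^- 2)%:E)%E) ->
  (0 < r)%N -> (forall i, (i < r)%N -> rigid_on n c M delta eta k (W i)) ->
  al <= be -> (forall x, al <= x <= be -> exists2 i, (i < r)%N & W i x) ->
  0 < m -> r%:R * y <= m -> (forall N : nat, y <= N%:R -> (4^-1) ^+ N <= delta) ->
  (P (many_roots X (weighted_poly c n) `[al, be]%classic m) <=
    (n.+1%:R * M ^- 2 + r%:R * q ^+ k)%:E)%E.
Proof.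
move=> ind M0 d0 Xq Xlarge r0 rig ab cov m0 rym yd.
have HB (i : 'I_r) : exists B : set T, [/\ measurable B,
    window_event X n c M delta (W i) `<=` B & (P B <= (q ^+ k)%:E)%E].
  by have [S mS [S1 S2]] := rigid_prob ind M0 d0 Xq (rig i (ltn_ord i)); exists S.
have [B BP] := choice HB.
pose L (j : 'I_n.+1) := X j @^-1` [set x | M <= `|x|].
have mL j : measurable (L j).
  by apply: measurable_RV_preimage; exact: measurable_norm_ge.
pose UL := \big[setU/set0]_(j < n.+1) L j.
pose UB := \big[setU/set0]_(i < r) B i.
have mUL : measurable UL by exact: bigsetU_measurable.
have mUB : measurable UB by apply: bigsetU_measurable => i _; case: (BP i).
have I0 : `[al, be]%classic !=set0 by exists al; rewrite /= in_itv /= lexx.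
have sub : many_roots X (weighted_poly c n) `[al, be]%classic m `<=` UL `|` UB.
  move=> w /= /(nroots_geP _ m0 I0) [rs [rsI mrs dv]].
  have [[j Lj]|small] := pselect (exists j : 'I_n.+1, L j w).
    by left; rewrite /UL (bigD1 j) //=; left.
  right; have [] := @pigeonhole_windows r W rs y r0.
  - by move=> x /rsI /=; rewrite in_itv /=; exact: cov.
  - exact: le_trans mrs.
  move=> i ir yi; rewrite /UB (bigD1 (Ordinal ir)) //=; left.
  have [_ + _] := BP (Ordinal ir); apply; split.
    move=> j jn; rewrite leNgt; apply/negP => h; apply: small.
    by exists (Ordinal (jn : (j < n.+1)%N)); rewrite /L /= ltW.
  exists [seq x <- rs | W i x]; split.
  - exact: filter_all.
  - by rewrite size_filter yd.
  - apply: dvdp_trans dv; rewrite big_filter [X in _ %| X](bigID (W i)) /=.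
    exact: dvdp_mulr.
apply: (@le_trans _ _ (P (UL `|` UB))).
  by apply: le_measure; rewrite ?inE //; [exact: measurable_many_roots|exact: measurableU].
rewrite (le_trans (measureU2 _ mUL mUB)) // EFinD leeD //.
  rewrite (le_trans (prob_bigsetU_le P _ _ mL)) //.
  apply: (@le_trans _ _ (\sum_(j < n.+1) (M ^- 2)%:E)%E).
    by apply: lee_sum => j _; exact: Xlarge.
  by rewrite sumEFin lee_fin sumr_const card_ord mulr_natl.
have mB i : measurable (B i) by case: (BP i).
rewrite (le_trans (prob_bigsetU_le P _ _ mB)) //.
apply: (@le_trans _ _ (\sum_(i < r) (q ^+ k)%:E)%E).
  by apply: lee_sum => i _; case: (BP i).
by rewrite sumEFin lee_fin sumr_const card_ord mulr_natl.
Qed.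
End Union.

(** * Covering an interval by windows in geometric progression *)

Section Cover.
Context (R : realType).

(** The parity of [i] is the sign and [i./2] the exponent, so that one index runs through both
    half-lines. *)
Definition window_center (lam : R) (i : nat) : R := (-1) ^+ odd i * (9^-1 * (1 + lam) ^+ i./2).

Definition cover_window (lam : R) (i : nat) : pred R :=
  if i is i'.+1 then fun x => `|x - window_center lam i'| <= lam * `|window_center lam i'|
  else fun x => `|x| <= 9^-1.

Lemma norm_window_center (lam : R) i : 0 <= lam -> `|window_center lam i| = 9^-1 * (1 + lam) ^+ i./2.
Proof.
move=> l0; have p0 : 0 <= 1 + lam by rewrite addr_ge0.
by rewrite normrM normr_sign mul1r ger0_norm // mulr_ge0 ?invr_ge0 ?exprn_ge0.
Qed.

(** The first power of [1 + lam] above [9 * |x|] places [|x|] between the moduli of two consecutive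
    centres, whose gap is [lam] times the smaller one. *)
Lemma cover_windowP (lam S : R) (m : nat) : 0 < lam -> 9 * S < (1 + lam) ^+ m.+1 ->
  forall x, - S <= x <= S -> exists2 i, (i < (2 * m.+1).+1)%N & cover_window lam i x.
Proof.
move=> l0 Sm x; rewrite -ler_norml => xS.
have [small|big] := leP `|x| 9^-1; first by exists 0%N.
have ex : exists j : nat, 9 * `|x| < (1 + lam) ^+ j.
  by exists m.+1; rewrite (le_lt_trans _ Sm) // ler_wpM2l.
have x9 : 1 < 9 * `|x| by rewrite -ltr_pdivrMl // mulr1.
case: (ex_minnP ex) => -[|i] xi H; first by move: xi; rewrite expr0 ltNge ltW.
have im : (i.+1 <= m.+1)%N by apply: H; rewrite (le_lt_trans _ Sm) // ler_wpM2l.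
have xlo : (1 + lam) ^+ i <= 9 * `|x|.
  by rewrite leNgt; apply/negP => /H; rewrite ltnn.
exists (2 * i + (x < 0)%R).+1; first by case: (x < 0)%R; lia.
have ctr : window_center lam (2 * i + (x < 0)%R) = (-1) ^+ (x < 0)%R * (9^-1 * (1 + lam) ^+ i).
  rewrite /window_center; congr ((-1) ^+ _ * (_ * _ ^+ _)); first by case: (x < 0)%R; lia.
  by case: (x < 0)%R; lia.
rewrite /= norm_window_center ?(ltW l0) //.
have -> : (2 * i + (x < 0)%R)./2 = i by case: (x < 0)%R; lia.
rewrite ctr {1}[x]numEsign -mulrBr normrM normr_sign mul1r.
move: xi; rewrite exprS => xi.
set p := (1 + lam) ^+ i in xlo xi *.
have x1 : 9^-1 * p <= `|x| by rewrite ler_pdivrMl.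
have x2 : `|x| < 9^-1 * ((1 + lam) * p) by rewrite ltr_pdivlMl.
by rewrite ger0_norm ?subr_ge0 //; lra.
Qed.

Lemma expR_half_le (lam : R) : 0 <= lam -> lam <= 1 -> expR (lam / 2) <= 1 + lam.
Proof.
move=> l0 l1; rewrite -[lam / 2]opprK expRN.
have h : 1 - lam / 2 <= expR (- (lam / 2)) by exact: expR_ge1Dx.
have p : 0 < 1 - lam / 2 by lra.
rewrite -[leLHS]mul1r ler_pdivrMr ?expR_gt0 //.
apply: (@le_trans _ _ ((1 + lam) * (1 - lam / 2))); first by nra.
by rewrite ler_wpM2l //; lra.
Qed.

(** Each root contributes at least a factor [expR (-1)], by squaring [2^-1 <= expR (- 2^-1)]. *)
Lemma quarter_exp (y : R) (N : nat) : y <= N%:R -> 4^-1 ^+ N <= expR (- y).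
Proof.
move=> yN.
have e4 : 4^-1 <= expR (-1) :> R.
  have h : 2^-1 <= expR (- 2^-1) :> R by rewrite (le_trans _ (expR_ge1Dx _)) //; lra.
  have -> : expR (-1) = expR (- 2^-1) * expR (- 2^-1) :> R by rewrite -expRD; congr expR; lra.
  have -> : 4^-1 = 2^-1 * 2^-1 :> R by field.
  by rewrite ler_pM // invr_ge0.
apply: (@le_trans _ _ (expR (-1) ^+ N)).
  by rewrite lerXn2r ?nnegrE ?expR_ge0 ?invr_ge0.
by rewrite -expRM_natl ler_expR mulrN1 lerN2.
Qed.

End Cover.

(** * Choice of the parameters for one interval *)

Section Bound.
Context (R : realType) (d : measure_display) (T : measurableType d) (P : probability T R).
Implicit Types (X : nat -> {RV P >-> R}) (c : nat -> R).

Lemma many_roots_bound X (n : nat) c (A C K a eta q g l s al be : R) :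
  mutually_independent X ->
  (forall j (u : R), (P (X j @^-1` `[(u - eta)%R, (u + eta)%R]%classic) <= q%:E)%E) ->
  (forall j (M : R), 0 < M -> (P (X j @^-1` [set x | (M <= `|x|)%R]) <= (M ^- 2)%:E)%E) ->
  regular_weights n c -> l = ln n%:R -> s = Num.sqrt n%:R ->
  0 < a -> 0 < eta -> 0 < q -> q < 1 -> 0 < g -> 2 * g <= - ln q / 100 -> 2 * g <= 2 ->
  100 <= l -> 9 * K < l -> C <= 100 * l -> 1 <= a * l ->
  1 + 169 / a + `|ln eta| <= 14 / 100 * l -> 3 - ln q <= g * a * l ->
  a * l ^+ 4 <= A -> A <= C * s ->
  - (K * s) <= al -> al <= be -> be <= K * s ->
  (P (many_roots X (weighted_poly c n) `[al, be]%classic (A * s)) <= (expR (- (g * A)))%:E)%E.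
Proof.
move=> ind Xq Xlarge reg lE sE a0 eta0 q0 q1 g0 gq g2 l100 Kl Cl al1 hl hg aA AC Kal ab beK.
have [s0 ns ne ls ls9] := ln_sqrt_bounds lE sE l100.
have l0 : 0 < l by lra.
have l31 : 100 <= l ^+ 3.
  by rewrite (le_trans l100) // ler_eXnr //; lra.
have A100 : 100 <= A.
  rewrite (le_trans _ aA) // exprS mulrA (le_trans l31) // ler_peMl //.
  by rewrite exprn_ge0 // ltW.
have A1 : 1 <= A by lra.
have A0 : 0 < A by lra.
have s1 : 1 <= s by lra.
have sn : s <= n%:R by rewrite ns expr2 ler_peMl // ltW.
have n1 : (0 < n)%N by rewrite -(ltr_nat R) (lt_le_trans s0).
have n1' : 1 <= n%:R :> R by rewrite ler1n.
(* This makes [n * lam ^+ 2 = l ^+ 4], which the lower bound on [A] keeps at most [A / a]. *)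
pose lam := l ^+ 2 / s.
have lam0 : 0 < lam by rewrite divr_gt0 // exprn_gt0.
have lam9 : lam <= 9^-1 by rewrite ler_pdivrMr // mulrC ler_pdivlMr // mulrC.
have lam1 : lam <= 1 by lra.
pose k := Num.truncn (A / 100).
have Ak0 : 0 <= A / 100 by rewrite divr_ge0 // ltW.
have /andP[kA Ak] := truncn_itv Ak0.
rewrite -/k in kA Ak.
have k0 : (0 < k)%N by rewrite truncn_gt0 ler_pdivlMr // mul1r.
have kn : (k <= n)%N.
  rewrite -(ler_nat R) (le_trans kA) // ler_pdivrMr // (le_trans AC) // ns.
  apply: (@le_trans _ _ (100 * l * s)); first by rewrite ler_wpM2r // ltW.
  by rewrite mulrC expr2 -mulrA ler_wpM2l ?(ltW s0) // mulrC ler_wpM2r.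
(* Large enough for [(1 + lam) ^+ m.+1 >= n], by [expR_half_le], and small enough that the centres
   stay below [n ^ 2]. *)
pose m := Num.truncn (2 * l / lam).
have lm0 : 0 <= 2 * l / lam by rewrite divr_ge0 ?(ltW lam0) // mulr_ge0 // ltW.
have /andP[ml lm] := truncn_itv lm0.
rewrite -/m in ml lm.
pose r := (2 * m.+1).+1.
have msl : 2 * l / lam = 2 * (s / l) by rewrite /lam; field; rewrite !gt_eqF.
have [r_le r_s] : r%:R <= 5 * (s / l) /\ 5 * (s / l) <= s.
  by apply: window_count l100 ls9 _; rewrite -msl.
have r_n : r%:R <= n%:R :> R by rewrite (le_trans r_le) // (le_trans r_s).
(* With [M = expR A] the tail of one coefficient is [expR A ^- 2]; [y] is the number of roots forced
   into one of the [r] windows, and [quarter_exp] turns it into [delta]. *)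
pose M := expR A; pose y := A * l / 5; pose delta := expR (- y).
have M0 : 0 < M by exact: expR_gt0.
have req := rigidity_condition l100 s0 ns ne ls9 (erefl lam) a0 eta0 aA A1 kA kn k0 hl.
have n3 : 1 <= n%:R ^+ 3 :> R by rewrite exprn_ege1.
have reqM : 3 * delta * M * n.+1%:R * (16 * k%:R * n%:R ^+ 3 / lam) ^+ k <= eta.
  apply: le_trans req; rewrite -[leRHS]mulrAC ler_peMr //.
    by rewrite !mulr_ge0 ?expR_ge0 // exprn_ge0 // !mulr_ge0 ?exprn_ge0 ?invr_ge0 ?(ltW lam0).
  by apply: expR_affine_ge1; rewrite mulr_ge0 // sqr_ge0.
have kn1 : (k <= n.+1)%N by exact: leq_trans kn (leqnSn n).
have n9 : 9 <= n%:R :> R.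
  by rewrite (le_trans _ sn) // (le_trans _ ls) // (le_trans _ l100) // ler_nat.
have rig i : (i < r)%N -> rigid_on n c M delta eta k (cover_window lam i).
  case: i => [_|i ir].
    apply: (rigid_near0 reg k0 kn1 _ n3 (ltW M0) (expR_ge0 _) lam0 lam9 reqM).
    by rewrite ler_eXnr.
  have im : (i./2 <= m)%N by move: ir; rewrite /r; clear; lia.
  have ax0 := norm_window_center i (ltW lam0).
  have p1 : 1 <= (1 + lam) ^+ i./2 by rewrite exprn_ege1 // lerDl ltW.
  have pn : (1 + lam) ^+ i./2 <= n%:R ^+ 2.
    apply: (@le_trans _ _ (expR lam ^+ i./2)).
      by rewrite lerXn2r ?nnegrE ?expR_ge0 ?expR_ge1Dx // addr_ge0 // ltW.
    rewrite -expRM_natl ne -expRM_natl ler_expR -ler_pdivlMr //.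
    by rewrite (le_trans _ ml) // ler_nat.
  (* [n ^ 3] serves for all ratios of neighbouring terms at once, since the centres have modulus
     between [9^-1] and [n ^ 2]. *)
  apply: (@rigid_far _ n k c M delta eta (n%:R ^+ 3) lam (window_center lam i)) => //.
  - by rewrite -normr_gt0 ax0 mulr_gt0 ?invr_gt0 // (lt_le_trans ltr01).
  - rewrite ax0 exprS ler_pM ?invr_ge0 ?exprn_ge0 ?addr_ge0 ?(ltW lam0) //.
    by rewrite (le_trans _ n1') // invf_le1 // ler1n.
  - rewrite ax0 mulrA; apply: (@le_trans _ _ (n%:R ^+ 3 * 9^-1)).
      rewrite exprS -mulrA ler_peMr // ler_pdivlMr // mul1r (le_trans n9) //.
      by rewrite expr2 ler_peMl.
    by rewrite ler_peMr // mulr_ge0 ?exprn_ge0 ?invr_ge0.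
  - exact: ltW.
  - exact: expR_ge0.
(* [9 * K < l] and [l <= s] bring the range below [s ^ 2 = n]. *)
have Sm : 9 * (K * s) < (1 + lam) ^+ m.+1.
  apply: (@lt_le_trans _ _ (l * s)); first by rewrite mulrA ltr_pM2r.
  apply: (@le_trans _ _ n%:R); first by rewrite ns expr2 ler_wpM2r // ltW.
  apply: (@le_trans _ _ (expR (lam / 2) ^+ m.+1)); last first.
    by rewrite lerXn2r ?nnegrE ?expR_ge0 ?expR_half_le ?addr_ge0 ?(ltW lam0).
  rewrite -expRM_natl ne ler_expR mulrA ler_pdivlMr // mulrC -ler_pdivrMr //.
  exact: ltW.
have Sy : r%:R * y <= A * s.
  apply: (@le_trans _ _ (5 * (s / l) * y)).
    by rewrite ler_wpM2r // /y !mulr_ge0 ?invr_ge0 // ltW.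
  by rewrite le_eqVlt /y; apply/orP; left; apply/eqP; field; rewrite gt_eqF.
have As0 : 0 < A * s by rewrite mulr_gt0.
have := many_roots_prob ind M0 (expR_gt0 _ : 0 < delta) Xq (fun j => Xlarge j M M0) (ltn0Sn _)
  rig ab _ As0 Sy (@quarter_exp _ y).
move=> H; apply: (le_trans (H _)).
  move=> x /andP[x1 x2]; apply: (@cover_windowP _ lam (K * s) m) => //.
  by rewrite (le_trans Kal x1) (le_trans x2 beK).
rewrite lee_fin; apply: (tail_condition l100 ne a0 aA q0 q1 _ r_n g0 gq g2 hg).
by rewrite lerBlDr natr1 ltW.
Qed.
End Bound.

(** * Passage to the i.i.d. copies and choice of the constants *)

Section Copies.
Context (R : realType) (d : measure_display) (T : measurableType d) (P : probability T R).

Lemma iid_preimage (xi0 : {RV P >-> R}) (xi : nat -> {RV P >-> R}) j (B : set R) :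
  iid_copies xi0 xi -> measurable B -> P (xi j @^-1` B) = P (xi0 @^-1` B).
Proof. by move=> [law _] mB; exact: law. Qed.

End Copies.

Theorem theorem2p11 (R : realType) (d : measure_display)
    (T : measurableType d) (P : probability T R)
    (xi0 : {RV P >-> R}) (xi : nat -> {RV P >-> R})
    (eps CE CW : R) (A : nat -> R)
    (mean0 : ('E_P[xi0] = 0)%E)
    (var1 : ('V_P[xi0] = 1)%E)
    (eps_gt0 : 0 < eps)
    (moment : ('E_P[fun w => (`|xi0 w| `^ (2 + eps))%R] < +oo)%E)
    (iid : iid_copies xi0 xi)
    (CE_gt0 : 0 < CE) (CW_gt1 : 1 < CW)
    (A_lower : vinogradov (fun n => ln n%:R ^+ 4) A)
    (A_upper : vinogradov A (fun n => Num.sqrt n%:R)) :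
  exists c c' : R, [/\ 0 < c, 0 < c' &
    \forall n \near \oo,
      let s := Num.sqrt n%:R : R in
      let I_E : set R := `[- (CE * s), CE * s]%classic in
      let I_W : set R := `[CW^-1 * s, CW * s]%classic in
      let I_W' : set R := `[- (CW * s), - (CW^-1 * s)]%classic in
      let bound : R :=
        2 `^ (- (c * A n)) + expR (- (c' * (s / ln n%:R ^+ 2))) in
      [/\ (P (many_roots xi (@elliptic_poly R n) I_E (A n * s)) <= bound%:E)%E,
          (P (many_roots xi (@weyl_poly R n) I_W (A n * s)) <= bound%:E)%E &
          (P (many_roots xi (@weyl_poly R n) I_W' (A n * s)) <= bound%:E)%E]].

Proof.
have [eta [q [eta0 q0 q1 Hq]]] := anticoncentration mean0 var1.
have [C1 [C10 HA]] := A_lower.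
have [C [C0 HC]] := A_upper.
pose a := C1^-1.
have a0 : 0 < a by rewrite invr_gt0.
have lq : ln q < 0 by rewrite ln_lt0 // q0.
(* Half of the rate [- ln q / 100], so that [tail_condition] has a spare [g * A] in the exponent. *)
pose g := Num.min (- ln q / 200) 1.
have g0 : 0 < g by rewrite lt_min ltr01 andbT divr_gt0 ?oppr_gt0 ?ltr0n.
have g1 : 2 * g <= - ln q / 100.
  have : g <= - ln q / 200 by rewrite ge_min lexx.
  lra.
have g2 : 2 * g <= 2.
  have : g <= 1 by rewrite ge_min lexx orbT.
  lra.
have l2 : 0 < ln 2 :> R by rewrite ln_gt0 // ltr1n.
(* The range [K * s] contains all three intervals. *)
pose K := CE + CW.
have K0 : 0 < K by rewrite addr_gt0 // (lt_trans ltr01).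
have ia0 : 0 < a^-1 by rewrite invr_gt0.
pose t := 1 + 169 / a + `|ln eta|.
have t0 : 0 <= t.
  exact: addr_ge0 (addr_ge0 ler01 (divr_ge0 (ler0n _ _) (ltW a0))) (normr_ge0 _).
have u0 : 0 <= 3 - ln q by rewrite subr_ge0 (le_trans (ltW lq)).
pose L := 100 + 9 * K + C + a^-1 + t * (100 / 14) + (3 - ln q) / (g * a) + 1.
(* Dividing [g] by [ln 2] changes base e to base 2; the second summand only adds a nonnegative
   amount, so 1 will do for [c']. *)
exists (g / ln 2), 1; split; [exact: divr_gt0|by []|].
have nearL := near_ln_ge L.
near=> n.
have lL : L <= ln n%:R by near: n.
have aA : a * ln n%:R ^+ 4 <= A n.
  have : `|ln n%:R ^+ 4| <= C1 * A n by near: n.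
  by rewrite ler_norml => /andP[_]; rewrite /a ler_pdivrMl.
have AC : A n <= C * Num.sqrt n%:R.
  have : `|A n| <= C * Num.sqrt n%:R by near: n.
  by rewrite ler_norml => /andP[].
have [l100 [Kl Cl al1 hl hg]] :=
  conditions_of_large a0 (mulr_gt0 g0 a0) (ltW K0) (ltW C0) t0 u0 lL.
have n0 : (0 < n)%N.
  by rewrite lt0n; apply: contraTneq l100 => n0; rewrite n0 ln0 // -ltNge ltr0n.
have main c al be : regular_weights n c -> - (K * Num.sqrt n%:R) <= al -> al <= be ->
    be <= K * Num.sqrt n%:R ->
    (P (many_roots xi (weighted_poly c n) `[al, be]%classic (A n * Num.sqrt n%:R))
       <= (expR (- (g * A n)))%:E)%E.
  move=> reg alo ab bhi.
  apply: (@many_roots_bound _ _ _ P xi n c (A n) C K a eta q g (ln n%:R)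
    (Num.sqrt n%:R) al be iid.2) => //.
  - by move=> j x; rewrite (iid_preimage j iid) ?Hq //; exact: measurable_itv.
  - by move=> j M M0; rewrite (iid_preimage j iid) ?prob_large //; exact: measurable_norm_ge.
have s0 : 0 <= Num.sqrt n%:R :> R by exact: sqrtr_ge0.
have [E1 E2 E3 /andP[W1 W2] W3] := interval_bounds CE_gt0 CW_gt1 s0.
have boundE : expR (- (g * A n)) <= 2 `^ (- (g / ln 2 * A n)) +
    expR (- (1 * (Num.sqrt n%:R / ln n%:R ^+ 2))).
  rewrite -[leLHS]addr0 lerD ?expR_ge0 // /powR pnatr_eq0 /= ler_expR mulNr lerN2.
  by rewrite mulrAC divfK // gt_eqF.
have wE c al be : regular_weights n c -> - (K * Num.sqrt n%:R) <= al -> al <= be ->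
    be <= K * Num.sqrt n%:R ->
    (P (many_roots xi (weighted_poly c n) `[al, be]%classic (A n * Num.sqrt n%:R))
       <= (2 `^ (- (g / ln 2 * A n)) + expR (- (1 * (Num.sqrt n%:R / ln n%:R ^+ 2))))%:E)%E.
  by move=> h1 h2 h3 h4; rewrite (le_trans (main c al be h1 h2 h3 h4)) // lee_fin.
split.
- rewrite (_ : @elliptic_poly R n = weighted_poly (elliptic_weight R n) n).
    by apply: wE => //; exact: regular_elliptic.
  by apply/funext => v; rewrite elliptic_polyE.
- by apply: wE => //; exact: regular_weyl.
- apply: wE; [exact: regular_weyl|by rewrite lerN2|by rewrite lerN2|].
  by rewrite -[leRHS]opprK lerN2.
Unshelve. all: by end_near. Qed.
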